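(* For every integer $N$ with $5\le N\le 23$, there exists a tight $N$-point simplex in $\mathbb{O}\mathbb{P}^2$.
   Context: $\mathbb{O}\mathbb{P}^2$ is the set of $3\times3$ octonionic Hermitian matrices $\Pi$ with $\Pi^2=\Pi$ and $\operatorname{Tr}\Pi=1$, with inner product $\langle A,B\rangle=\operatorname{Re}\operatorname{Tr}(AB)$. A tight simplex of $N$ points in $\mathbb{O}\mathbb{P}^2$ is a set of $N$ distinct points $\Pi_1,\dots,\Pi_N$ with $\langle\Pi_i,\Pi_j\rangle=\frac{N-3}{3(N-1)}$ for all $i\ne j$. *)

(* Defs.v *)
From HB Require Import structures.
From mathcomp Require Import all_boot all_order all_algebra.
From mathcomp Require Import reals.
Set Implicit Arguments. Unset Strict Implicit. Unset Printing Implicit Defensive.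
Import Order.TTheory GRing.Theory Num.Theory.
Local Open Scope ring_scope.

Record alg (R : Type) (T : Type) := Alg {
  a0 : T; a1 : T;
  aadd : T -> T -> T; aopp : T -> T;
  amul : T -> T -> T; aconj : T -> T;
  are : T -> R }.

Definition base_alg (R : nzRingType) : alg R R :=
  @Alg R R 0 1 +%R -%R *%R id id.

(* Cayley-Dickson doubling: (a,b)(c,d) = (ac - conj(d) b, d a + b conj(c)),
   conj(a,b) = (conj(a), -b), Re (a,b) = Re a. *)
Definition cd_alg (R T : Type) (A : alg R T) : alg R (T * T) :=
  @Alg R (T * T) (a0 A, a0 A) (a1 A, a0 A)
    (fun x y => (aadd A x.1 y.1, aadd A x.2 y.2))
    (fun x => (aopp A x.1, aopp A x.2))
    (fun x y => (aadd A (amul A x.1 y.1) (aopp A (amul A (aconj A y.2) x.2)),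
                 aadd A (amul A y.2 x.1) (amul A x.2 (aconj A y.1))))
    (fun x => (aconj A x.1, aopp A x.2))
    (fun x => are A x.1).

Definition oct (R : Type) := (((R * R) * (R * R)) * ((R * R) * (R * R)))%type.
Definition octA (R : nzRingType) : alg R (oct R) :=
  cd_alg (cd_alg (cd_alg (base_alg R))).

Section OctMatrices.
Variable R : nzRingType.
Local Notation O := (octA R).

Definition omulmx (A B : 'M[oct R]_3) : 'M[oct R]_3 :=
  \matrix_(i, j) \big[aadd O / a0 O]_(k < 3) amul O (A i k) (B k j).

Definition otrace (A : 'M[oct R]_3) : oct R :=
  \big[aadd O / a0 O]_(i < 3) A i i.

Definition ohermitian (A : 'M[oct R]_3) : Prop :=
  forall i j, A j i = aconj O (A i j).

Definition oinner (A B : 'M[oct R]_3) : R := are O (otrace (omulmx A B)).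

Definition in_OP2 (P : 'M[oct R]_3) : Prop :=
  ohermitian P /\ omulmx P P = P /\ otrace P = a1 O.

End OctMatrices.

Definition tight_simplex (R : realType) (N : nat) (P : 'I_N -> 'M[oct R]_3) : Prop :=
  (forall i, in_OP2 (P i)) /\ injective P /\
  (forall i j, i != j ->
     oinner (P i) (P j) = (N%:R - 3) / (3 * (N%:R - 1)) :> R).

(* Main.v *)
(* Look for a configuration invariant under a cyclic group of order 8 acting on the
   octonionic projective plane, its orbits having the lengths 8, ..., 8, 4, 2, 1 given
   by the binary expansion of N.  The equations <P_i, P_j> = c alone are linearly
   dependent at a tight simplex, where the sum of all inner products is minimal; so
   each orbit gets a slack e_o, the inner products are only required to be
   c + e_o + e_o', and the sum of all points is required to be (N/3) I.  Taking the inner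
   product of a point with that sum forces all slacks to vanish.  The enlarged system
   has a nondegenerate zero near an explicit rational point: with a numerical inverse A
   of the Jacobian, y |-> y - F (x0 + A y) contracts a small ball, which is verified by
   fixed-point interval arithmetic for values and slopes. *)
From Stdlib Require Import ZArith.
Require Import Defs.
From HB Require Import structures.
From mathcomp Require Import all_boot all_order all_algebra zify ssrZ ring lra.
From mathcomp Require Import reals boolp classical_sets functions interval_inference.
From mathcomp Require Import topology normedtype sequences.
Set Implicit Arguments. Unset Strict Implicit. Unset Printing Implicit Defensive.
Import Order.TTheory GRing.Theory Num.Theory numFieldNormedType.Exports.
Local Open Scope ring_scope.
(* [%Z] denotes [int] here. *)
Delimit Scope Z_scope with BZ.

(** * The system of equations, over an arbitrary algebra of scalars *)

(** The generator of the group carries the sign matrix diag(1, 1, -1) so that few Hermitian matrices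
    are fixed by it: only the diagonal and two real coordinates of the entry (1,0) survive. The sum
    of all points is fixed, so prescribing it costs four equations, the fifth coordinate following
    from the traces.

    The variables outnumber the equations. All but a square selection of them stay frozen at their
    rational values, and only the selected ones are moved. The approximate inverse is applied to the
    variables rather than to the equations: the ball then has one coordinate per equation, the slope
    of equation i has only to be near the i-th unit vector, and the inverse enters through exactly
    known slopes of affine inputs, so its inaccuracy creates no error term of its own.

    The two precisions reflect what has to be tested: the residual at the centre must be tiny
    compared with the ball, whereas slopes need only give a contraction factor 1/2. *)

Definition herm (T : Type) : Type := ((T * T * T) * (oct T * oct T * oct T))%type.

Section System.
Variables (T : Type) (A : alg T T).
Local Notation "x +' y" := (aadd A x y) (at level 50, left associativity).
Local Notation "x *' y" := (amul A x y) (at level 40, left associativity).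
Local Notation "-' x" := (aopp A x) (at level 35).
Local Notation O := (cd_alg (cd_alg (cd_alg A))).

Definition odot (x y : oct T) : T :=
  let: (((x0, x1), (x2, x3)), ((x4, x5), (x6, x7))) := x in
  let: (((y0, y1), (y2, y3)), ((y4, y5), (y6, y7))) := y in
  x0 *' y0 +' x1 *' y1 +' x2 *' y2 +' x3 *' y3 +'
  x4 *' y4 +' x5 *' y5 +' x6 *' y6 +' x7 *' y7.

Definition oscale (s : T) (x : oct T) : oct T :=
  let: (((x0, x1), (x2, x3)), ((x4, x5), (x6, x7))) := x in
  (((s *' x0, s *' x1), (s *' x2, s *' x3)), ((s *' x4, s *' x5), (s *' x6, s *' x7))).

(* [((a, b, c), (x, y, z))] stands for the Hermitian matrix with diagonal
   [a, b, c] and with [x, y, z] at the positions (1,0), (2,0), (1,2). *)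
Definition outer (w : T * oct T * oct T) : herm T :=
  let: (s, u, v) := w in
  ((s *' s, odot u u, odot v v), (oscale s u, oscale s v, amul O u (aconj O v))).

Definition hdot (P Q : herm T) : T :=
  let: ((a, b, c), (x, y, z)) := P in
  let: ((a', b', c'), (x', y', z')) := Q in
  let d := odot x x' +' odot y y' +' odot z z' in
  a *' a' +' b *' b' +' c *' c' +' (d +' d).

(* [hphi] is conjugation by diag(1, 1, -1) after the entrywise application of the
   octonion automorphism [ophi]. *)
Definition ophi (x : oct T) : oct T :=
  let: (((x0, x1), (x2, x3)), ((x4, x5), (x6, x7))) := x in
  (((x0, x1), (-' x3, x2)), ((x7, x6), (x4, -' x5))).

Definition hphi (P : herm T) : herm T :=
  let: (d, (x, y, z)) := P in
  (d, (ophi x, aopp O (ophi y), aopp O (ophi z))).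

(** One slack, one real entry, and the free coordinates of two octonions. For [d = 1] the sign in
    [hphi] forces the second octonion to be 0, which leaves two coordinates. *)
Definition params (d : nat) : nat :=
  match d with 8 => 18 | 4 => 10 | 2 => 6 | _ => 4 end.

(* Entry 0 of [l] is the slack of the orbit.  The zero pattern makes the point
   invariant under [hphi] iterated [d] times. *)
Definition point (d : nat) (l : seq T) : T * oct T * oct T :=
  let e i := nth (a0 A) l i in let z := a0 A in
  match d with
  | 8 => (e 1, (((e 2, e 3), (e 4, e 5)), ((e 6, e 7), (e 8, e 9))),
               (((e 10, e 11), (e 12, e 13)), ((e 14, e 15), (e 16, e 17))))
  | 4 => (e 1, (((e 2, e 3), (e 4, e 5)), ((z, z), (z, z))),
               (((e 6, e 7), (e 8, e 9)), ((z, z), (z, z))))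
  | 2 => (e 1, (((e 2, e 3), (z, z)), ((z, z), (z, z))),
               (((e 4, e 5), (z, z)), ((z, z), (z, z))))
  | _ => (e 1, (((e 2, e 3), (z, z)), ((z, z), (z, z))),
               (((z, z), (z, z)), ((z, z), (z, z))))
  end%N.

Record orbit := Orbit { olen : nat; oslack : T; orep : herm T }.

Fixpoint orbits (ds : seq nat) (l : seq T) : seq orbit :=
  match ds with
  | [::] => [::]
  | d :: ds => let l1 := take (params d) l in
      Orbit d (nth (a0 A) l1 0) (outer (point d l1)) :: orbits ds (drop (params d) l)
  end.

Definition htrace (h : herm T) : T := h.1.1.1 +' h.1.1.2 +' h.1.2.

Definition pair_eq (c : T) (o p : orbit) (k : nat) : T :=
  hdot (orep o) (iter k hphi (orep p)) +' -' (c +' (oslack o +' oslack p)).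

(** Since [hphi] is an isometry, an inner product depends only on the difference of the two shifts.
    Inside one orbit of length d the shifts k and d - k give the same value, hence the range up to
    d/2. *)
Fixpoint pair_eqs (c : T) (os : seq orbit) : seq T :=
  match os with
  | [::] => [::]
  | o :: os =>
     (htrace (orep o) +' -' (a1 A))
     :: [seq pair_eq c o o k | k <- iota 1 (olen o)./2]
     ++ flatten [seq [seq pair_eq c o p k | k <- iota 0 (olen p)] | p <- os]
     ++ pair_eqs c os
  end.

Definition orbit_sum (f : herm T -> T) (os : seq orbit) : T :=
  foldr (fun o t => iter (olen o) (aadd A (f (orep o))) t) (a0 A) os.

(** These are the coordinates that [hphi] leaves unchanged, so each orbit contributes its length
    times the value at the representative. The last diagonal entry is determined by the trace
    equations. *)
Definition sum_eqs (third : T) (os : seq orbit) : seq T :=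
  [:: orbit_sum (fun h => h.1.1.1) os +' -' third;
      orbit_sum (fun h => h.1.1.2) os +' -' third;
      orbit_sum (fun h => h.2.1.1.1.1.1) os;
      orbit_sum (fun h => h.2.1.1.1.1.2) os].

Definition system (c third : T) (ds : seq nat) (l : seq T) : seq T :=
  let os := orbits ds l in pair_eqs c os ++ sum_eqs third os.

End System.

(** The descending order matters: [pair_eqs] runs over shifts modulo the length of the later orbit,
    which here divides that of the earlier one. Otherwise some equations would occur twice and the
    Jacobian would be singular. *)
Definition orbit_sizes (N : nat) : seq nat :=
  nseq (N %/ 8) 8 ++ nseq (N %% 8 %/ 4) 4 ++ nseq (N %% 4 %/ 2) 2 ++ nseq (N %% 2) 1.

(** * Jets in fixed-point arithmetic *)

Section Jets.
Local Open Scope Z_scope.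

(* Values and their errors are in units of 2^-32, slopes in units of 2^-16;
   [jerr0] bounds the error at the centre, [jerr] the one on the ball of radius
   2^-20, and [jrem] is a Lipschitz constant for the nonlinear part. *)
Record jet := Jet { jval : Z; jerr0 : Z; jerr : Z; jgrad : seq Z; jrem : Z }.

Fixpoint gcomb (a : Z) (g : seq Z) (b : Z) (h : seq Z) : seq Z :=
  match g, h with
  | [::], _ => map (fun y => Z.shiftr (b * y) 16) h
  | _, [::] => map (fun x => Z.shiftr (a * x) 16) g
  | x :: g, y :: h => Z.shiftr (a * x + b * y) 16 :: gcomb a g b h
  end.

Fixpoint gadd (g h : seq Z) : seq Z :=
  match g, h with
  | [::], _ => h
  | _, [::] => g
  | x :: g, y :: h => (x + y) :: gadd g h
  end.

Definition gnorm (g : seq Z) : Z := foldr (fun x t => Z.abs x + t) 0 g.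
Definition glen (g : seq Z) : Z := foldr (fun _ t => t + 1) 0 g.

(** The summand 2 is one unit for rounding the product and one for rounding this bound. *)
Definition mul_err (vf ef vh eh : Z) : Z :=
  Z.shiftr (Z.abs vf * eh + (Z.abs vh + eh) * ef) 32 + 2.

Definition jconst (v e : Z) : jet := Jet v e e [::] 0.

Definition jadd (f h : jet) : jet :=
  Jet (jval f + jval h) (jerr0 f + jerr0 h) (jerr f + jerr h)
      (gadd (jgrad f) (jgrad h)) (jrem f + jrem h).

Definition jopp (f : jet) : jet :=
  Jet (- jval f) (jerr0 f) (jerr f) (map Z.opp (jgrad f)) (jrem f).

(** In the last field, each [+ 2] covers the truncation of a value and of its error bound, [+ 1]
    that of the whole sum, and [glen g] one unit for every rounded slope. *)
Definition jmul (f h : jet) : jet :=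
  let a := Z.shiftr (jval f) 16 in
  let b := Z.shiftr (jval h) 16 in
  let g := gcomb b (jgrad f) a (jgrad h) in
  Jet (Z.shiftr (jval f * jval h) 32)
      (mul_err (jval f) (jerr0 f) (jval h) (jerr0 h))
      (mul_err (jval f) (jerr f) (jval h) (jerr h))
      g
      (Z.shiftr (Z.abs a * jrem h + Z.abs b * jrem f
         + (Z.shiftr (jerr f) 16 + 2) * (gnorm (jgrad h) + jrem h)
         + (Z.shiftr (jerr h) 16 + 2) * (gnorm (jgrad f) + jrem f)) 16
       + 1 + glen g).

Definition jet_alg : alg jet jet :=
  Alg (jconst 0 0) (jconst (2 ^ 32) 0) jadd jopp jmul id id.

Definition jfrac (p q : Z) : jet := jconst (p * 2 ^ 32 / q) 1.

(* The shift converts 2^-16 (slopes) times 2^-20 (radius) to units of 2^-32. *)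
Definition jaffine (v : Z) (g : seq Z) : jet :=
  Jet v 0 (Z.shiftr (gnorm g) 4 + 1) g 0.

Definition jvars (grad : nat -> seq Z) (xs : seq Z) : seq jet :=
  [seq jaffine (nth 0 xs i) (grad i) | i <- iota 0 (size xs)].

Definition jsystem (N : nat) (grad : nat -> seq Z) (xs : seq Z) : seq jet :=
  let n := Z.of_nat N in
  system jet_alg (jfrac (n - 3) (3 * (n - 1))) (jfrac n 3) (orbit_sizes N) (jvars grad xs).

(** The l^1 distance of [g] from the i-th unit vector, i.e. the row of I - DF measured for the
    operator norm of the sup norm. Missing entries count as 0, so a list that ends before the
    diagonal still contributes 2^16. *)
Fixpoint row_defect (i : nat) (g : seq Z) : Z :=
  match i, g with
  | 0%N, x :: g => Z.abs (x - 2 ^ 16) + gnorm g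
  | i.+1, x :: g => Z.abs x + row_defect i g
  | _, [::] => 2 ^ 16
  end.

(* 2048 is half the radius 2^-20 in units of 2^-32, and 32768 is 1/2 in units of 2^-16. *)
Definition newton_check (F : seq jet) : bool :=
  all (fun i => let f := nth (jconst 0 0) F i in
         Z.leb (Z.abs (jval f) + jerr0 f) 2048
         && Z.leb (row_defect i (jgrad f) + jrem f) 32768)
      (iota 0 (size F)).

(** One step of elimination on [M | I], storing only the nontrivial columns: the cleared pivot
    column is dropped and the new column of the right half appended. The pivot row also moves to the
    end, so the next pivot is again in the top left corner, and after one step per row everything is
    back in order, with the inverse in place of M. *)
Definition gj_step (M : seq (seq Z)) : seq (seq Z) :=
  if M is (p :: r) :: rows then
    let r' := rcons [seq x * 2 ^ 16 / p | x <- r] (2 ^ 32 / p) in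
    rcons [seq if row is a :: row' then
                 gadd (rcons row' 0) [seq - Z.shiftr (a * y) 16 | y <- r']
               else [::] | row <- rows] r'
  else M.

(** The empty gradient freezes a variable outside [piv] at its numerical value. *)
Definition column (piv : seq nat) (B : nat -> seq Z) (i : nat) : seq Z :=
  if i \in piv then B (index i piv) else [::].

(* Fixed-point Gauss-Jordan inversion of the Jacobian with respect to the
   variables [piv]; nothing about its accuracy is assumed, [newton_check] tests
   the outcome. *)
Definition precond (N : nat) (xs : seq Z) (piv : seq nat) : seq (seq Z) :=
  let J := jsystem N (column piv (fun j => rcons (nseq j 0) (2 ^ 16))) xs in
  let M := [seq jgrad f ++ nseq (size piv - size (jgrad f)) 0 | f <- J] in
  iter (size M) gj_step M.

Definition certificate (N : nat) (xs : seq Z) (piv : seq nat) : bool :=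
  let B := precond N xs piv in
  let F := jsystem N (column piv (nth [::] B)) xs in
  newton_check F.

End Jets.

(** * Soundness of the jets *)

Section ZtoR.
Variable R : realType.
Definition zr (z : Z) : R := (int_of_Z z)%:~R.

Lemma zrD x y : zr (Z.add x y) = zr x + zr y.
Proof. by rewrite /zr -intrD -rmorphD. Qed.

Lemma zrM x y : zr (Z.mul x y) = zr x * zr y.
Proof. by rewrite /zr -intrM -rmorphM. Qed.

Lemma zrN x : zr (Z.opp x) = - zr x.
Proof. by rewrite /zr -rmorphN -rmorphN. Qed.

Lemma zrB x y : zr (Z.sub x y) = zr x - zr y.
Proof. by rewrite /Z.sub zrD zrN. Qed.

Lemma zr_nat n : zr (Z.of_nat n) = n%:R.
Proof. by rewrite /zr (_ : int_of_Z _ = n%:Z)//; lia. Qed.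

Lemma zr_le x y : Z.le x y -> zr x <= zr y.
Proof.
move=> xy; rewrite ler_int; lia.
Qed.

Lemma zr_gt0 x : Z.lt 0 x -> 0 < zr x.
Proof. by move=> x0; rewrite ltr0z; lia. Qed.

Lemma zr_abs x : zr (Z.abs x) = `|zr x|.
Proof. by rewrite /zr -intr_norm; congr (_%:~R); lia. Qed.

Lemma zr_pow2 n : zr (2 ^ Z.of_nat n)%BZ = 2 ^+ n.
Proof.
elim: n => [|n ih] //; rewrite Nat2Z.inj_succ Z.pow_succ_r; last lia.
by rewrite zrM ih exprS (zr_nat 2).
Qed.

Lemma zr_shiftr x k :
  let q := zr (Z.shiftr x (Z.of_nat k)) * 2 ^+ k in q <= zr x <= q + 2 ^+ k.
Proof.
rewrite /= -zr_pow2 -zrM -zrD Z.shiftr_div_pow2; last lia.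
have p0 : Z.lt 0 (2 ^ Z.of_nat k) by apply: Z.pow_pos_nonneg; lia.
have := Z.div_mod x (2 ^ Z.of_nat k)%BZ; have := Z.mod_pos_bound x _ p0.
by move=> H1 H2; apply/andP; split; apply: zr_le; nia.
Qed.

Lemma glen_size (g : seq Z) : zr (glen g) = (size g)%:R.
Proof. by elim: g => [|x g ih] //=; rewrite zrD ih -natr1. Qed.

End ZtoR.

(** * Slopes as linear forms, estimated in the sup norm *)

Section Slopes.
Variables (R : realType) (m : nat).
Local Notation V := 'rV[R]_m.
Local Notation zr := (@zr R).
Implicit Types (g h : seq Z) (d : V).

Definition lin (g : seq Z) (d : V) : R := \sum_(j < m) zr (nth 0%BZ g j) * d 0 j.

Lemma entry_le_norm d j : `|d 0 j| <= `|d|.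
Proof.
by rewrite [leRHS]/Num.norm /= mx_normrE; apply/bigmax_geP; right => /=; exists (0, j).
Qed.

Lemma lin_gadd g h d : lin (gadd g h) d = lin g d + lin h d.
Proof.
rewrite /lin -big_split; apply: eq_bigr => j _ /=; rewrite -mulrDl -zrD; congr (zr _ * _).
elim: g h {j}(j : nat) => [|x g ih] [|y h] [|j] //=; rewrite ?nth_nil; lia.
Qed.

Lemma lin_opp g d : lin (map Z.opp g) d = - lin g d.
Proof.
rewrite /lin -sumrN; apply: eq_bigr => j _; rewrite -mulNr -zrN; congr (zr _ * _).
elim: g {j}(j : nat) => [|x g ih] [|j] //=.
Qed.

Lemma linB g d d' : lin g d - lin g d' = lin g (d - d').
Proof. by rewrite /lin -sumrB; apply: eq_bigr => j _; rewrite -mulrBr !mxE. Qed.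

Lemma gnorm_ge0 g : Z.le 0 (gnorm g).
Proof. by elim: g => //= a g; lia. Qed.

Lemma gnorm_ge_sum n g : \sum_(j < n) `|zr (nth 0%BZ g j)| <= zr (gnorm g).
Proof.
elim: n g => [|n ih] [|x g] /=.
- by rewrite big_ord0.
- rewrite big_ord0; apply: (@zr_le _ 0%BZ); have := @gnorm_ge0 g; lia.
- by rewrite big1 // => j _; rewrite nth_nil normr0.
- by rewrite big_ord_recl /= zrD zr_abs lerD2l; apply: ih.
Qed.

Lemma lin_le g d : `|lin g d| <= zr (gnorm g) * `|d|.
Proof.
apply: (le_trans (ler_norm_sum _ _ _)).
apply: (@le_trans _ _ (\sum_(j < m) `|zr (nth 0%BZ g j)| * `|d|)).
  by apply: ler_sum => j _; rewrite normrM ler_wpM2l// entry_le_norm.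
by rewrite -mulr_suml ler_wpM2r// gnorm_ge_sum.
Qed.

(** Entries past the end of the list are exact; this is why the total rounding error in [lin_gcomb]
    is governed by the length of the list. *)
Lemma gcomb_entry a g b h j :
  `|zr (nth 0%BZ (gcomb a g b h) j) * 2 ^+ 16
    - (zr a * zr (nth 0%BZ g j) + zr b * zr (nth 0%BZ h j))|
  <= if (j < size (gcomb a g b h))%N then 2 ^+ 16 else 0.
Proof.
have shr16 x : `|zr (Z.shiftr x 16) * 2 ^+ 16 - zr x| <= 2 ^+ 16.
  have /= := @zr_shiftr R x 16 => /andP[h1 h2].
  by rewrite ler_norml; apply/andP; split; move: h1 h2; lra.
elim: g h j => [h j|x g ih [j|y h [|j]]].
- rewrite /= size_map nth_nil mulr0 add0r; case: ltnP => jh.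
    by rewrite (nth_map 0%BZ)// -zrM.
  by rewrite !nth_default ?size_map// !(mul0r, mulr0) subrr normr0.
- have -> : gcomb a (x :: g) b [::] = map (fun x => Z.shiftr (a * x) 16) (x :: g) by [].
  rewrite nth_nil mulr0 addr0 size_map; case: ltnP => jh.
    by rewrite (nth_map 0%BZ)// -zrM.
  by rewrite !nth_default ?size_map// !(mul0r, mulr0) subrr normr0.
- by rewrite /= -!zrM -zrD.
- exact: ih.
Qed.

Lemma lin_gcomb a g b h d :
  `|lin (gcomb a g b h) d * 2 ^+ 16 - (zr a * lin g d + zr b * lin h d)|
  <= zr (glen (gcomb a g b h)) * 2 ^+ 16 * `|d|.
Proof.
pose e j := zr (nth 0%BZ (gcomb a g b h) j) * 2 ^+ 16
            - (zr a * zr (nth 0%BZ g j) + zr b * zr (nth 0%BZ h j)).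
have -> : lin (gcomb a g b h) d * 2 ^+ 16 - (zr a * lin g d + zr b * lin h d)
        = \sum_(j < m) e j * d 0 j.
  rewrite /lin mulr_suml !mulr_sumr -big_split -sumrB; apply: eq_bigr => j _.
  by rewrite /e /=; ring.
have he j : `|e j| <= if (j < size (gcomb a g b h))%N then 2 ^+ 16 else 0 by exact: gcomb_entry.
apply: (le_trans (ler_norm_sum _ _ _)).
apply: (@le_trans _ _ (\sum_(j < m) (if (j < size (gcomb a g b h))%N then 2 ^+ 16 else 0) * `|d|)).
  by apply: ler_sum => j _; rewrite normrM ler_pM// entry_le_norm.
rewrite -mulr_suml ler_wpM2r// glen_size.
elim: m (size _) => [|n ih] [|s]; rewrite ?big_ord0 ?mul0r ?mulr_ge0//.
  by rewrite big1.
rewrite big_ord_recl /= -[s.+1%:R]natr1 mulrDl mul1r addrC lerD2r.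
by apply: le_trans (ih s); apply: ler_sum => i _; rewrite /bump /= add1n ltnS.
Qed.

Lemma row_defect_ge i g d (H : (i < m)%N) :
  `|d 0 (Ordinal H) * 2 ^+ 16 - lin g d| <= zr (row_defect i g) * `|d|.
Proof.
have -> : d 0 (Ordinal H) * 2 ^+ 16 - lin g d
   = \sum_(j < m) ((if j == i :> nat then 2 ^+ 16 else 0) - zr (nth 0%BZ g j)) * d 0 j.
  under eq_bigr do rewrite mulrBl.
  rewrite sumrB /lin; congr (_ - _).
  rewrite (bigD1 (Ordinal H)) //= eqxx big1 ?addr0 1?mulrC//.
  by move=> j jH; rewrite -val_eqE /= in jH; rewrite (negbTE jH) mul0r.
apply: (le_trans (ler_norm_sum _ _ _)).
apply: (@le_trans _ _ (\sum_(j < m)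
  `|(if j == i :> nat then 2 ^+ 16 else 0) - zr (nth 0%BZ g j)| * `|d|)).
  by apply: ler_sum => j _; rewrite normrM ler_wpM2l// entry_le_norm.
rewrite -mulr_suml ler_wpM2r// {d}.
elim: m g i H => [|n ih] g [|i] //= H.
- rewrite big_ord_recl /=; case: g => [|x g].
    rewrite big1 => [|j _]; last by rewrite nth_nil subrr normr0.
    by rewrite /= subr0 addr0 ger0_norm ?exprn_ge0// -(zr_pow2 _ 16).
  rewrite zrD zr_abs zrB (zr_pow2 _ 16) /= distrC lerD2l.
  by apply: le_trans (gnorm_ge_sum n g); rewrite le_eqVlt; apply/orP; left; apply/eqP;
     apply: eq_bigr => j _; rewrite sub0r normrN.
- rewrite big_ord_recl /=; case: g => [|x g].
    rewrite /= subr0 normr0 add0r.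
    have := ih [::] i H; rewrite (_ : row_defect i [::] = (2 ^ 16)%BZ); last by case: (i).
    apply: le_trans; apply: ler_sum => j _.
    by rewrite !nth_nil /bump /= add1n eqSS.
  rewrite zrD zr_abs sub0r normrN lerD2l.
  by apply: le_trans (ih g i H); apply: ler_sum => j _; rewrite /bump /= add1n eqSS.
Qed.
End Slopes.

(** * Error propagation through the jet operations *)

Section Soundness.
Variables (R : realType) (m : nat).
Local Notation V := 'rV[R]_m.
Local Notation zr := (@zr R).

Lemma mul_err_sound (F H : R) vf ef vh eh :
  `|F * 2 ^+ 32 - zr vf| <= zr ef -> `|H * 2 ^+ 32 - zr vh| <= zr eh ->
  `|F * H * 2 ^+ 32 - zr (Z.shiftr (vf * vh) 32)| <= zr (mul_err vf ef vh eh).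
Proof.
rewrite /mul_err zrD.
have /= := @zr_shiftr R (Z.abs vf * eh + (Z.abs vh + eh) * ef)%BZ 32.
have /= := @zr_shiftr R (vf * vh)%BZ 32.
rewrite !(zrD, zrM, zr_abs) (zr_nat _ 2).
set v := zr (Z.shiftr _ _); set X := zr (Z.shiftr _ _).
have : 0 < 2 ^+ 32 :> R by rewrite exprn_gt0.
move: (2 ^+ 32) => q q0 /andP[h1 h2] /andP[_ h3] hf hh.
rewrite -(ler_pM2l q0) -[X in X * `|_|](gtr0_norm q0) -normrM.
have -> : q * (F * H * q - v) =
  zr vf * (H * q - zr vh) + (F * q - zr vf) * (zr vh + (H * q - zr vh)) + (zr vf * zr vh - v * q).
  by ring.
have t1 : `|zr vf * (H * q - zr vh)| <= `|zr vf| * zr eh by rewrite normrM ler_wpM2l.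
have t2 : `|(F * q - zr vf) * (zr vh + (H * q - zr vh))| <= zr ef * (`|zr vh| + zr eh).
  by rewrite normrM ler_pM// (le_trans (ler_normD _ _))// lerD2l.
have t3 : `|zr vf * zr vh - v * q| <= q by rewrite ler_norml; apply/andP; split; lra.
apply: (le_trans (ler_normD _ _)); apply: (le_trans (lerD (ler_normD _ _) (lexx _))).
nra.
Qed.

(** The slope condition compares two arbitrary points of the ball, as a contraction estimate
    requires, and avoids derivatives. The centre has its own error bound because the residual test
    there is far finer than the variation over the ball. *)
Record jet_sound (j : jet) (f : V -> R) : Prop := JetSound {
  sound0 : `|f 0 * 2 ^+ 32 - zr (jval j)| <= zr (jerr0 j);
  sound_ball : forall y, `|y| * 2 ^+ 20 <= 1 ->
    `|f y * 2 ^+ 32 - zr (jval j)| <= zr (jerr j);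
  sound_slope : forall y y', `|y| * 2 ^+ 20 <= 1 -> `|y'| * 2 ^+ 20 <= 1 ->
    `|(f y - f y') * 2 ^+ 16 - lin (jgrad j) (y - y')| <= zr (jrem j) * `|y - y'|;
  sound_rem : 0 <= zr (jrem j) }.

Lemma lin_nil (d : V) : lin [::] d = 0.
Proof. by rewrite /lin big1// => j _; rewrite nth_nil mul0r. Qed.

Lemma jconst_sound v e (c : R) :
  `|c * 2 ^+ 32 - zr v| <= zr e -> jet_sound (jconst v e) (fun _ => c).
Proof.
by move=> h; split=> //= y y' _ _; rewrite subrr mul0r lin_nil subrr normr0 mulr_ge0.
Qed.

Lemma ler_normBD (a a' b b' c c' : R) :
  `|a - b| <= c -> `|a' - b'| <= c' -> `|(a + a') - (b + b')| <= c + c'.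
Proof.
by move=> h h'; rewrite opprD addrACA; apply: le_trans (lerD h h'); exact: ler_normD.
Qed.

Lemma jadd_sound j j' f f' :
  jet_sound j f -> jet_sound j' f' -> jet_sound (jadd j j') (fun y => f y + f' y).
Proof.
move=> [h0 hB hL hs] [h0' hB' hL' hs']; split; rewrite /= ?zrD.
- by rewrite mulrDl; exact: ler_normBD.
- by move=> y yB; rewrite mulrDl; apply: ler_normBD; [exact: hB|exact: hB'].
- move=> y y' yB yB'; rewrite lin_gadd (mulrDl (zr _)) (_ : (_ - _) * _ =
    (f y - f y') * 2 ^+ 16 + (f' y - f' y') * 2 ^+ 16); last by ring.
  by apply: ler_normBD; [exact: hL|exact: hL'].
- exact: addr_ge0.
Qed.

Lemma jopp_sound j f : jet_sound j f -> jet_sound (jopp j) (fun y => - f y).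
Proof.
move=> [h0 hB hL hs]; split; rewrite /= ?zrN.
- by rewrite mulNr -opprD normrN.
- by move=> y yB; rewrite mulNr -opprD normrN hB.
- by move=> y y' yB yB'; rewrite lin_opp -opprD mulNr -opprD normrN hL.
- by [].
Qed.

Lemma coarse_sound j f y : jet_sound j f -> `|y| * 2 ^+ 20 <= 1 ->
  `|f y * 2 ^+ 16 - zr (Z.shiftr (jval j) 16)| <= zr (Z.shiftr (jerr j) 16 + 2).
Proof.
move=> [_ hB _ _] /hB; rewrite (exprD _ 16 16) mulrA zrD (zr_nat _ 2).
have /= := @zr_shiftr R (jval j) 16; have /= := @zr_shiftr R (jerr j) 16.
have : 0 < 2 ^+ 16 :> R by rewrite exprn_gt0.
move: (2 ^+ 16) => q q0 /andP[_ h1] /andP[h2 h3]; rewrite !ler_norml => /andP[h4 h5].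
by apply/andP; split; rewrite -(ler_pM2r q0); lra.
Qed.

Lemma lin_sound_le j f y y' : jet_sound j f -> `|y| * 2 ^+ 20 <= 1 -> `|y'| * 2 ^+ 20 <= 1 ->
  `|(f y - f y') * 2 ^+ 16| <= zr (gnorm (jgrad j) + jrem j) * `|y - y'|.
Proof.
move=> [_ _ hL _] yB yB'; rewrite zrD (mulrDl (zr _)).
rewrite (_ : (f y - f y') * _ = lin (jgrad j) (y - y') +
  ((f y - f y') * 2 ^+ 16 - lin (jgrad j) (y - y'))); last by ring.
by apply: (le_trans (ler_normD _ _)); apply: lerD; [exact: lin_le|exact: hL].
Qed.

(** From F H - F' H' = F (H - H') + H' (F - F'), with F and H' replaced by the approximations a and
    b: the replacement errors multiply the full Lipschitz bounds Lh and Lf, while a and b multiply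
    only the slope remainders. The term n q is the rounding of the combined slope. *)
Lemma slope_mul (F F' H H' a b lf lh l sf sh Lf Lh Ef Eh n s D q : R) :
  0 < q -> 0 <= D ->
  `|F * q - a| <= Ef -> `|H' * q - b| <= Eh ->
  `|(F - F') * q - lf| <= sf * D -> `|(H - H') * q - lh| <= sh * D ->
  `|(F - F') * q| <= Lf * D -> `|(H - H') * q| <= Lh * D ->
  `|l * q - (b * lf + a * lh)| <= n * q * D ->
  `|a| * sh + `|b| * sf + Ef * Lh + Eh * Lf + n * q <= s * q ->
  `|(F * H - F' * H') * q - l| <= s * D.
Proof.
move=> q0 D0 hF hH' hf hh hlf hlh hl hs.
rewrite -(ler_pM2r q0) -[X in _ * X <= _](gtr0_norm q0) -normrM.
have -> : ((F * H - F' * H') * q - l) * q =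
  a * ((H - H') * q - lh) + b * ((F - F') * q - lf)
  + (F * q - a) * ((H - H') * q) + (H' * q - b) * ((F - F') * q)
  - (l * q - (b * lf + a * lh)) by ring.
have t1 := ler_wpM2l (normr_ge0 a) hh; have t2 := ler_wpM2l (normr_ge0 b) hf.
have t3 := ler_pM (normr_ge0 _) (normr_ge0 _) hF hlh.
have t4 := ler_pM (normr_ge0 _) (normr_ge0 _) hH' hlf.
have t5 := ler_wpM2r D0 hs.
rewrite -!normrM in t1 t2 t3 t4.
apply: (le_trans (ler_normB _ _)).
apply: (le_trans (lerD (ler_normD _ _) (lexx _))).
apply: (le_trans (lerD (lerD (ler_normD _ _) (lexx _)) (lexx _))).
apply: (le_trans (lerD (lerD (lerD (ler_normD _ _) (lexx _)) (lexx _)) (lexx _))).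
lra.
Qed.

Lemma jmul_sound j j' f f' :
  jet_sound j f -> jet_sound j' f' -> jet_sound (jmul j j') (fun y => f y * f' y).
Proof.
move=> hj hj'.
have in0 : `|0 : V| * 2 ^+ 20 <= 1 by rewrite normr0 mul0r ler01.
pose a := Z.shiftr (jval j) 16; pose b := Z.shiftr (jval j') 16.
pose G := gcomb b (jgrad j) a (jgrad j').
pose X := (Z.abs a * jrem j' + Z.abs b * jrem j
         + (Z.shiftr (jerr j) 16 + 2) * (gnorm (jgrad j') + jrem j')
         + (Z.shiftr (jerr j') 16 + 2) * (gnorm (jgrad j) + jrem j))%BZ.
have gn0 g : 0 <= zr (gnorm g) by apply: (@zr_le _ 0%BZ); exact: gnorm_ge0.
have XE : zr X + zr (glen G) * 2 ^+ 16 <= zr (jrem (jmul j j')) * 2 ^+ 16.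
  have -> : jrem (jmul j j') = (Z.shiftr X 16 + 1 + glen G)%BZ by [].
  have /andP[_ h] := @zr_shiftr R X 16.
  by rewrite 2!zrD (zr_nat _ 1) 2!mulrDl mul1r lerD2r.
have XD : zr X = `|zr a| * zr (jrem j') + `|zr b| * zr (jrem j)
    + zr (Z.shiftr (jerr j) 16 + 2) * zr (gnorm (jgrad j') + jrem j')
    + zr (Z.shiftr (jerr j') 16 + 2) * zr (gnorm (jgrad j) + jrem j).
  by rewrite /X 3!zrD 4!zrM 2!zr_abs.
have q0 : 0 < 2 ^+ 16 :> R by rewrite exprn_gt0.
split.
- exact: mul_err_sound (sound0 hj) (sound0 hj').
- by move=> y yB; apply: mul_err_sound (sound_ball hj yB) (sound_ball hj' yB).
- move=> y y' yB yB'.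
  apply: (slope_mul q0 (normr_ge0 _) (coarse_sound hj yB) (coarse_sound hj' yB')
    (sound_slope hj yB yB') (sound_slope hj' yB yB') (lin_sound_le hj yB yB')
    (lin_sound_le hj' yB yB') (lin_gcomb _ _ _ _ _)).
  by apply: le_trans XE; rewrite XD.
- rewrite -(ler_pM2r q0) mul0r; apply: le_trans XE.
  have e0 := le_trans (normr_ge0 _) (coarse_sound hj in0).
  have e0' := le_trans (normr_ge0 _) (coarse_sound hj' in0).
  have s0 := sound_rem hj; have s0' := sound_rem hj'.
  rewrite XD !(zrD _ (gnorm _)) glen_size.
  by rewrite !addr_ge0 ?mulr_ge0 ?addr_ge0// ltW.
Qed.

Lemma jaffine_sound v g :
  jet_sound (jaffine v g) (fun y => zr v / 2 ^+ 32 + lin g y / 2 ^+ 16).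
Proof.
have p0 : 2 ^+ 16 != 0 :> R by rewrite expf_neq0.
have e1 z : z / 2 ^+ 32 * 2 ^+ 32 = z :> R by rewrite divfK// expf_neq0.
have e2 z : z / 2 ^+ 16 * 2 ^+ 16 = z :> R by rewrite divfK.
have lin0 : lin g (0 : V) = 0 by rewrite /lin big1// => j _; rewrite mxE mulr0.
split=> [|y yB|y y' _ _|] /=.
- by rewrite lin0 mul0r addr0 e1 subrr normr0.
- rewrite mulrDl e1 addrC addKr -[in leLHS](mulr1 (lin g y)) (exprD _ 16 16).
  rewrite mulr1 mulrA e2 normrM (ger0_norm (exprn_ge0 _ _))//.
  have /andP[_] := @zr_shiftr R (gnorm g) 4; rewrite zrD (zr_nat _ 1) => h.
  have l := lin_le g y.
  have g0 : 0 <= zr (gnorm g) by apply: (@zr_le _ 0%BZ); exact: gnorm_ge0.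
  have h4 : 0 < 2 ^+ 4 :> R by rewrite exprn_gt0.
  rewrite -(ler_pM2r h4) -mulrA -exprD (mulrDl _ 1) mul1r; apply: le_trans h.
  apply: (le_trans (ler_wpM2r _ l)); rewrite ?exprn_ge0// -mulrA.
  by rewrite -[leRHS]mulr1 ler_wpM2l.
- rewrite opprD addrACA subrr add0r -mulrBl e2 linB subrr normr0.
  by rewrite mulr_ge0.
- by [].
Qed.

Lemma jfrac_sound p q : Z.lt 0 q -> jet_sound (jfrac p q) (fun _ => zr p / zr q).
Proof.
move=> q0; apply: jconst_sound.
have q0' : 0 < zr q by exact: zr_gt0.
have E : zr (p * 2 ^ 32)%BZ = zr p * 2 ^+ 32 by rewrite zrM -(zr_pow2 _ 32).
have h1 := Z.div_mod (p * 2 ^ 32)%BZ q; have h2 := Z.mod_pos_bound (p * 2 ^ 32)%BZ q q0.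
have h3 : Z.le (p * 2 ^ 32 / q * q) (p * 2 ^ 32) by lia.
have h4 : Z.le (p * 2 ^ 32) (p * 2 ^ 32 / q * q + q) by lia.
move/(@zr_le R): h3; move/(@zr_le R): h4; rewrite zrD E (zrM _ (_ / q)%BZ) => h4 h3.
rewrite (zr_nat _ 1) -(ler_pM2r q0') -[X in _ * X <= _](gtr0_norm q0') -normrM.
rewrite mulrBl mulrAC divfK ?gt_eqF// ler_norml; apply/andP; split; lra.
Qed.

End Soundness.

(** * The Newton step *)

HB.instance Definition _ (R : realType) (m n : nat) := Complete.on 'M[R]_(m, n).

Section Newton.
Variables (R : realType) (m : nat).
Local Notation V := 'rV[R]_m.

Lemma mx_norm_le (d : V) (c : R) : 0 <= c -> (forall j, `|d 0 j| <= c) -> `|d| <= c.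
Proof.
move=> c0 h; rewrite [leLHS]/Num.norm /= mx_normrE.
by apply/bigmax_leP; split => // -[i j] _; rewrite ord1.
Qed.

(** The map T y = y - F y sends the ball to itself because |T y| is at most |T y - T 0| + |F 0|,
    hence at most r/2 + r/2; the Banach fixed point theorem then applies, and a fixed point of T is
    a zero of F. *)
Lemma newton_contraction (F : V -> V) (r : R) : 0 <= r ->
  (forall y y', `|y| <= r -> `|y'| <= r ->
     `|(y - F y) - (y' - F y')| <= 2^-1 * `|y - y'|) ->
  `|F 0| <= r / 2 -> exists2 y, `|y| <= r & F y = 0.
Proof.
move=> r0 hF h0.
pose U : set V := closed_ball_ (fun x => `|x|) 0 r.
have inU y : U y <-> `|y| <= r by rewrite /U /closed_ball_ /= sub0r normrN.
pose T (y : V) : V := y - F y.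
have TU : set_fun U U T.
  move=> y /inU yU; apply/inU.
  have := hF y 0 yU; rewrite normr0 => /(_ r0); rewrite !subr0 => h.
  have -> : T y = (y - F y - (0 - F 0)) + - F 0 by rewrite /T sub0r opprK addrK.
  apply: (le_trans (ler_normD _ _)); rewrite normrN sub0r opprK.
  rewrite sub0r opprK in h; lra.
have ct : is_contraction (mkfun TU).
  exists (2^-1)%:nng; split => /=; first by lra.
  by move=> -[y y'] [/= /inU yU /inU yU']; exact: hF.
have [||y /inU yU yE] := banach_fixed_point ct.
- exact: closed_closed_ball_.
- by exists 0; apply/inU; rewrite normr0.
exists y => //; move: yE; rewrite /= /T => /eqP.
by rewrite eq_sym subr_eq addrC -subr_eq subrr eq_sym => /eqP.
Qed.

Lemma newton_zero (F : seq jet) (f : nat -> V -> R) :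
  size F = m -> (forall i, (i < m)%N -> jet_sound (nth (jconst 0 0) F i) (f i)) ->
  newton_check F -> exists y : V, forall i, (i < m)%N -> f i y = 0.
Proof.
move=> sF hf /allP chk.
pose Phi (y : V) : V := \row_(i < m) f i y.
have chk' (i : 'I_m) : let j := nth (jconst 0 0) F i in
    (zr R (Z.abs (jval j) + jerr0 j) <= 2 ^+ 11) /\
    (zr R (row_defect i (jgrad j) + jrem j) <= 2 ^+ 15).
  have /chk /andP[h1 h2] : nat_of_ord i \in iota 0 (size F) by rewrite mem_iota sF /=.
  split; last by rewrite -(zr_pow2 _ 15); apply/zr_le/Z.leb_le.
  by rewrite -(zr_pow2 _ 11); apply/zr_le/Z.leb_le.
have r0 : 0 <= 2 ^- 20 :> R by rewrite invr_ge0 exprn_ge0.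
have inB (y : V) : (`|y| <= 2 ^- 20) = (`|y| * 2 ^+ 20 <= 1).
  by rewrite -ler_pdivlMr ?exprn_gt0// mul1r.
have [||y _ yE] := @newton_contraction Phi (2 ^- 20) r0; last first.
  exists y => i im; have := congr1 (fun v : V => v 0 (Ordinal im)) yE.
  by rewrite !mxE.
- apply: mx_norm_le => [|i]; first by rewrite divr_ge0.
  rewrite mxE; have [h _] := chk' i; have := sound0 (hf i (ltn_ord i)).
  move: h; rewrite zrD zr_abs; set j := nth _ _ _ => h hs.
  have {}h : `|f i 0 * 2 ^+ 32| <= 2 ^+ 11.
    apply: le_trans h; rewrite -[X in `|X|](subrK (zr R (jval j))) addrC.
    by apply: (le_trans (ler_normD _ _)); rewrite lerD2l.
  have h2 : 2 ^- 20 / 2 * 2 ^+ 32 = 2 ^+ 11 :> R.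
    have -> : 2 ^+ 32 = 2 ^+ 20 * (2 * 2 ^+ 11) :> R by rewrite -exprS -exprD.
    have : 2 ^+ 20 != 0 :> R by rewrite expf_neq0.
    by move: (2 ^+ 20) (2 ^+ 11) => p x p0; field.
  rewrite -(@ler_pM2r _ (2 ^+ 32)) ?exprn_gt0// h2.
  by move: h; rewrite normrM (ger0_norm (exprn_ge0 _ _)).
- move=> y y'; rewrite !inB => yB yB'.
  apply: mx_norm_le => [|i]; first by rewrite mulr_ge0.
  have [_ h] := chk' i; have hs := sound_slope (hf i (ltn_ord i)) yB yB'.
  move: h hs; set j := nth _ _ _; rewrite zrD => h hs.
  have := row_defect_ge (jgrad j) (y - y') (ltn_ord i).
  rewrite (_ : Ordinal _ = i); last exact: val_inj.
  rewrite !mxE; have := normr_ge0 (y - y').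
  have q0 : 0 < 2 ^+ 16 :> R by rewrite exprn_gt0.
  have qE : 2 ^+ 16 = 2 * 2 ^+ 15 :> R by rewrite -exprS.
  move: `|y - y'| (lin _ _) hs h => D L hs h D0 h1.
  rewrite -(ler_pM2r q0) -[X in _ * X <= _](gtr0_norm q0) -normrM.
  (* The first bracket is the deviation of the slope from the i-th unit vector, the second the
     nonlinear remainder; [newton_check] bounds the sum of the two constants by 2^15, half of
     2^16. *)
  have -> : (y 0 i - f i y - (y' 0 i - f i y')) * 2 ^+ 16 =
     ((y 0 i - y' 0 i) * 2 ^+ 16 - L) - ((f i y - f i y') * 2 ^+ 16 - L) by ring.
  apply: (le_trans (ler_normB _ _)); apply: (le_trans (lerD h1 hs)).
  by rewrite -mulrDl mulrAC ler_wpM2r// (le_trans h)// qE; lra.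
Qed.

End Newton.

(** * Parametricity of the system in its algebra of scalars *)

Section Parametricity.
Variables (R1 R2 : Type).

(* [system] is evaluated over jets, over functions on the ball, and over [R] at a point
   of the ball; [sim] carries its results from one to the next. *)
Record sim (T1 T2 : Type) (A1 : alg R1 T1) (A2 : alg R2 T2) (r : T1 -> T2 -> Prop) : Prop := Sim {
  sim0 : r (a0 A1) (a0 A2);
  sim1 : r (a1 A1) (a1 A2);
  simD : forall x x' y y', r x x' -> r y y' -> r (aadd A1 x y) (aadd A2 x' y');
  simN : forall x x', r x x' -> r (aopp A1 x) (aopp A2 x');
  simM : forall x x' y y', r x x' -> r y y' -> r (amul A1 x y) (amul A2 x' y');
  simC : forall x x', r x x' -> r (aconj A1 x) (aconj A2 x') }.

Definition prel (T1 T2 : Type) (r : T1 -> T2 -> Prop) (x : T1 * T1) (y : T2 * T2) : Prop :=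
  r x.1 y.1 /\ r x.2 y.2.

Lemma cd_sim T1 T2 (A1 : alg R1 T1) (A2 : alg R2 T2) r :
  sim A1 A2 r -> sim (cd_alg A1) (cd_alg A2) (prel r).
Proof.
move=> [s0 s1 sD sN sM sC]; split; rewrite /prel //=.
- by move=> x x' y y' [? ?] [? ?]; split; apply: sD.
- by move=> x x' [? ?]; split; apply: sN.
- by move=> x x' y y' [? ?] [? ?]; split; apply: sD; auto.
- by move=> x x' [? ?]; split; auto.
Qed.

End Parametricity.

Section SystemSim.
Variables (T1 T2 : Type) (A1 : alg T1 T1) (A2 : alg T2 T2) (r : T1 -> T2 -> Prop).
Hypothesis rA : sim A1 A2 r.
Local Notation orel := (prel (prel (prel r))).
Local Notation lrel := (List.Forall2 r).

Let rD := simD rA. Let rM := simM rA. Let rN := simN rA. Let r0 := sim0 rA.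

Lemma odot_sim x x' y y' : orel x x' -> orel y y' -> r (odot A1 x y) (odot A2 x' y').
Proof.
move: x x' y y' => [[[? ?] [? ?]] [[? ?] [? ?]]] [[[? ?] [? ?]] [[? ?] [? ?]]].
move=> [[[? ?] [? ?]] [[? ?] [? ?]]] [[[? ?] [? ?]] [[? ?] [? ?]]].
move=> [[[/= ? ?] [/= ? ?]] [[/= ? ?] [/= ? ?]]] [[[/= ? ?] [/= ? ?]] [[/= ? ?] [/= ? ?]]].
by rewrite /odot; repeat apply: rD; apply: rM.
Qed.

Lemma oscale_sim s s' x x' : r s s' -> orel x x' -> orel (oscale A1 s x) (oscale A2 s' x').
Proof.
move: x x' => [[[? ?] [? ?]] [[? ?] [? ?]]] [[[? ?] [? ?]] [[? ?] [? ?]]] ?.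
by move=> [[[/= ? ?] [/= ? ?]] [[/= ? ?] [/= ? ?]]]; repeat split; apply: rM.
Qed.

Lemma ophi_sim x x' : orel x x' -> orel (ophi A1 x) (ophi A2 x').
Proof.
move: x x' => [[[? ?] [? ?]] [[? ?] [? ?]]] [[[? ?] [? ?]] [[? ?] [? ?]]].
by move=> [[[/= ? ?] [/= ? ?]] [[/= ? ?] [/= ? ?]]]; repeat split => //=; apply: rN.
Qed.

Definition hrel (P : herm T1) (Q : herm T2) : Prop :=
  [/\ r P.1.1.1 Q.1.1.1, r P.1.1.2 Q.1.1.2 & r P.1.2 Q.1.2] /\
  [/\ orel P.2.1.1 Q.2.1.1, orel P.2.1.2 Q.2.1.2 & orel P.2.2 Q.2.2].

Lemma hphi_sim P P' : hrel P P' -> hrel (hphi A1 P) (hphi A2 P').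
Proof.
move: P P' => [d [[x y] z]] [d' [[x' y'] z']] [/= hd [/= hx hy hz]].
have oN := simN (cd_sim (cd_sim (cd_sim rA))).
by split => //=; split; [exact: ophi_sim|apply: oN; exact: ophi_sim|apply: oN; exact: ophi_sim].
Qed.

Lemma iter_hphi_sim k P P' : hrel P P' -> hrel (iter k (hphi A1) P) (iter k (hphi A2) P').
Proof. by move=> h; elim: k => //= k; exact: hphi_sim. Qed.

Lemma hdot_sim P P' Q Q' : hrel P P' -> hrel Q Q' -> r (hdot A1 P Q) (hdot A2 P' Q').
Proof.
move: P P' Q Q' => [[[a b] c] [[x y] z]] [[[a' b'] c'] [[x' y'] z']].
move=> [[[d e] f] [[u v] w]] [[[d' e'] f'] [[u' v'] w']].
move=> [[/= ? ? ?] [/= ? ? ?]] [[/= ? ? ?] [/= ? ? ?]]; rewrite /hdot.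
have h : r (aadd A1 (aadd A1 (odot A1 x u) (odot A1 y v)) (odot A1 z w))
           (aadd A2 (aadd A2 (odot A2 x' u') (odot A2 y' v')) (odot A2 z' w')).
  by apply: rD; [apply: rD|]; apply: odot_sim.
by apply: rD; [apply: rD; [apply: rD|]|apply: rD => //]; apply: rM.
Qed.

Definition wrel (w : T1 * oct T1 * oct T1) (w' : T2 * oct T2 * oct T2) : Prop :=
  [/\ r w.1.1 w'.1.1, orel w.1.2 w'.1.2 & orel w.2 w'.2].

Lemma outer_sim w w' : wrel w w' -> hrel (outer A1 w) (outer A2 w').
Proof.
move: w w' => [[s u] v] [[s' u'] v'] [/= hs hu hv].
have o3 := cd_sim (cd_sim (cd_sim rA)).
split; split => /=; first [exact: rM|exact: odot_sim|exact: oscale_sim|idtac].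
exact: (simM o3 hu (simC o3 hv)).
Qed.

Lemma lrel_nth l l' i d d' : r d d' -> lrel l l' -> r (nth d l i) (nth d' l' i).
Proof. by move=> hd h; elim: h i => [|x y {}l {}l' hx _ ih] [|i] //=. Qed.

Lemma lrel_take n l l' : lrel l l' -> lrel (take n l) (take n l').
Proof. by move=> h; elim: h n => [|x y {}l {}l' hx _ ih] [|n] /=; constructor. Qed.

Lemma lrel_drop n l l' : lrel l l' -> lrel (drop n l) (drop n l').
Proof. by move=> h; elim: h n => [|x y {}l {}l' hx hl ih] [|n] //=; constructor. Qed.

Lemma lrel_cat l l' k k' : lrel l l' -> lrel k k' -> lrel (l ++ k) (l' ++ k').
Proof. by move=> h hk; elim: h => [|x y {}l {}l' hx _ ih] //=; constructor. Qed.

Lemma lrel_map (I : Type) (s : seq I) f f' :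
  (forall i, r (f i) (f' i)) -> lrel (map f s) (map f' s).
Proof. by move=> h; elim: s => [|i s ih] /=; constructor. Qed.

Lemma point_sim d l l' : lrel l l' -> wrel (point A1 d l) (point A2 d l').
Proof.
move=> hl; have e i : r (nth (a0 A1) l i) (nth (a0 A2) l' i) by exact: lrel_nth.
rewrite /point; do 9 (case: d => [|d]; first by split; repeat split; first [exact: e|exact: r0]).
by split; repeat split; first [exact: e|exact: r0].
Qed.

Definition orbrel (o : orbit T1) (p : orbit T2) : Prop :=
  [/\ olen o = olen p, r (oslack o) (oslack p) & hrel (orep o) (orep p)].

Lemma orbits_sim ds l l' : lrel l l' ->
  List.Forall2 orbrel (orbits A1 ds l) (orbits A2 ds l').
Proof.
elim: ds l l' => [|d ds ih] l l' hl /=; constructor; last exact/ih/lrel_drop.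
have ht := lrel_take (params d) hl.
by split => //=; [exact: lrel_nth|apply/outer_sim/point_sim].
Qed.

Lemma pair_eq_sim c c' o o' p p' k : r c c' -> orbrel o o' -> orbrel p p' ->
  r (pair_eq A1 c o p k) (pair_eq A2 c' o' p' k).
Proof.
move=> hc [_ so ho] [_ sp hp]; apply: rD; first by apply: hdot_sim => //; exact: iter_hphi_sim.
by apply: rN; apply: rD => //; apply: rD.
Qed.

Lemma pair_eqs_sim c c' os os' : r c c' -> List.Forall2 orbrel os os' ->
  lrel (pair_eqs A1 c os) (pair_eqs A2 c' os').
Proof.
move=> hc; elim=> [|o o' {}os {}os' ho hos ih] /=; first by constructor.
have [lo so [[h1 h2 h3] _]] := ho; constructor.
  by apply: rD; [apply: rD => //; apply: rD|apply: rN; exact: sim1 rA].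
rewrite lo; apply: lrel_cat; first by apply: lrel_map => k; exact: pair_eq_sim.
apply: lrel_cat => //; elim: hos => [|p p' ps ps' hp _ ih'] /=; first by constructor.
by apply: lrel_cat => //; case: (hp) => -> _ _; apply: lrel_map => k; exact: pair_eq_sim.
Qed.

Lemma orbit_sum_sim f f' os os' :
  (forall h h', hrel h h' -> r (f h) (f' h')) -> List.Forall2 orbrel os os' ->
  r (orbit_sum A1 f os) (orbit_sum A2 f' os').
Proof.
move=> hf; elim=> [|o o' {}os {}os' [lo _ ho] _ ih] //=; rewrite lo.
by elim: (olen o') => //= n ihn; apply: rD => //; exact: hf.
Qed.

Lemma system_sim c c' t t' ds l l' : r c c' -> r t t' -> lrel l l' ->
  lrel (system A1 c t ds l) (system A2 c' t' ds l').
Proof.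
move=> hc ht hl; have hos := orbits_sim ds hl.
apply: lrel_cat; first exact: pair_eqs_sim.
constructor; last constructor; last constructor; last constructor => //.
- by apply: rD; [apply: orbit_sum_sim => // h h' [[]]|exact: rN].
- by apply: rD; [apply: orbit_sum_sim => // h h' [[]]|exact: rN].
- by apply: orbit_sum_sim => // h h' [_ [[[[]]]]].
- by apply: orbit_sum_sim => // h h' [_ [[[[]]]]].
Qed.

End SystemSim.

(** * From a successful check to a real zero of the system *)

Section Certificate.
Variable R : realType.

Definition fun_alg (V : Type) : alg (V -> R) (V -> R) :=
  Alg (fun _ => 0) (fun _ => 1) (fun f g y => f y + g y) (fun f y => - f y)
      (fun f g y => f y * g y) id id.

Lemma jet_sim m : sim jet_alg (fun_alg 'rV[R]_m) (@jet_sound R m).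
Proof.
split=> /=.
- by apply: jconst_sound; rewrite mul0r subrr normr0.
- by apply: jconst_sound; rewrite mul1r (zr_pow2 _ 32) subrr normr0.
- by move=> x x' y y'; exact: jadd_sound.
- by move=> x x'; exact: jopp_sound.
- by move=> x x' y y'; exact: jmul_sound.
- by [].
Qed.

Lemma eval_sim (V : Type) (y : V) : sim (fun_alg V) (base_alg R) (fun f x => f y = x).
Proof. by split=> //= [x x' z z' -> ->|x x' ->|x x' z z' -> ->]. Qed.

Lemma certificate_zero N xs piv : (1 < N)%N -> certificate N xs piv ->
  exists l : seq R, forall i,
    nth 0 (system (base_alg R) ((N%:R - 3) / (3 * (N%:R - 1))) (N%:R / 3)
                  (orbit_sizes N) l) i = 0.
Proof.
move=> N1; rewrite /certificate; set g := column _ _; set F := jsystem _ _ _ => chk.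
pose n := Z.of_nat N; pose m := size F.
pose vars := [seq (fun y : 'rV[R]_m => zr R (nth 0%BZ xs i) / 2 ^+ 32 + lin (g i) y / 2 ^+ 16)
             | i <- iota 0 (size xs)].
pose fs := system (fun_alg 'rV[R]_m) (fun _ => zr R (n - 3) / zr R (3 * (n - 1)))
  (fun _ => zr R n / zr R 3) (orbit_sizes N) vars.
have hF : List.Forall2 (@jet_sound R m) F fs.
  apply: (system_sim (jet_sim m)); [apply: jfrac_sound; lia|apply: jfrac_sound; lia|].
  by rewrite /jvars /vars; apply: lrel_map => i; exact: jaffine_sound.
have [|y hy] := @newton_zero R m F (fun i => nth (fun _ => 0) fs i) erefl _ chk.
  by move=> i _; apply: lrel_nth => //; exact: sim0 (jet_sim m).
exists [seq f y | f <- vars] => i.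
have e : List.Forall2 (fun (f : 'rV[R]_m -> R) x => f y = x) fs
    (system (base_alg R) ((N%:R - 3) / (3 * (N%:R - 1))) (N%:R / 3) (orbit_sizes N)
       [seq f y | f <- vars]).
  apply: (system_sim (eval_sim y)).
  - by rewrite zrM !zrB (zr_nat _ N) (zr_nat _ 3) (zr_nat _ 1).
  - by rewrite (zr_nat _ N) (zr_nat _ 3).
  - by rewrite /vars; elim: (iota 0 _) => [|j s ih] /=; constructor.
have := @lrel_nth _ _ _ _ _ i (fun _ => 0) 0 erefl e => <-.
(* Past the last equation [nth] returns the zero function, in agreement with the default 0. *)
have [im|im] := ltnP i m; first exact: hy.
have sE : size F = size fs := List.Forall2_length hF.
by rewrite nth_default// -sE.
Qed.

End Certificate.

(** * Geometry of the orbits *)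

Section Geometry.
Variable R : realType.
Local Notation B := (base_alg R).
Local Notation O := (octA R).
Implicit Types (P Q X : herm R) (w : R * oct R * oct R).

Definition oreal (a : R) : oct R := (((a, 0), (0, 0)), ((0, 0), (0, 0))).

Definition hmx (P : herm R) : 'M[oct R]_3 :=
  let: ((a, b, c), (x, y, z)) := P in
  \matrix_(i, j) match (i : nat), (j : nat) with
    | 0%N, 0%N => oreal a | 0%N, 1%N => aconj O x | 0%N, _ => aconj O y
    | 1%N, 0%N => x | 1%N, 1%N => oreal b | 1%N, _ => z
    | _, 0%N => y | _, 1%N => aconj O z | _, _ => oreal c
    end.

Lemma oinner_hmx P Q : oinner (hmx P) (hmx Q) = hdot B P Q.
Proof.
move: P Q => [[[a b] c] [[x y] z]] [[[a' b'] c'] [[x' y'] z']].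
rewrite /oinner /otrace !big_ord_recl !big_ord0 !mxE !big_ord_recl !big_ord0 !mxE /hdot /odot.
move: x y z x' y' z' => [[[? ?] [? ?]] [[? ?] [? ?]]] [[[? ?] [? ?]] [[? ?] [? ?]]]
  [[[? ?] [? ?]] [[? ?] [? ?]]] [[[? ?] [? ?]] [[? ?] [? ?]]]
  [[[? ?] [? ?]] [[? ?] [? ?]]] [[[? ?] [? ?]] [[? ?] [? ?]]] /=.
ring.
Qed.

Definition wphi (w : R * oct R * oct R) : R * oct R * oct R :=
  let: (s, u, v) := w in (s, ophi B u, aopp O (ophi B v)).

(** This expresses that [ophi] is multiplicative on u times the conjugate of v, with the sign
    absorbed into v. It keeps the whole orbit in the form [outer], so that [outer_idem] applies to
    every point. *)
Lemma hphi_outer w : hphi B (outer B w) = outer B (wphi w).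
Proof.
move: w => [[s [[[? ?] [? ?]] [[? ?] [? ?]]]] [[[? ?] [? ?]] [[? ?] [? ?]]]] /=.
by congr ((_, _, _), ((((_, _), (_, _)), ((_, _), (_, _))),
  (((_, _), (_, _)), ((_, _), (_, _))), (((_, _), (_, _)), ((_, _), (_, _))))); ring.
Qed.

Lemma hdot_hphi P Q : hdot B (hphi B P) (hphi B Q) = hdot B P Q.
Proof.
move: P Q => [[[a b] c] [[x y] z]] [[[a' b'] c'] [[x' y'] z']].
move: x y z x' y' z' => [[[? ?] [? ?]] [[? ?] [? ?]]] [[[? ?] [? ?]] [[? ?] [? ?]]]
  [[[? ?] [? ?]] [[? ?] [? ?]]] [[[? ?] [? ?]] [[? ?] [? ?]]]
  [[[? ?] [? ?]] [[? ?] [? ?]]] [[[? ?] [? ?]] [[? ?] [? ?]]] /=.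
ring.
Qed.

Lemma hdotC P Q : hdot B P Q = hdot B Q P.
Proof.
move: P Q => [[[a b] c] [[x y] z]] [[[a' b'] c'] [[x' y'] z']].
move: x y z x' y' z' => [[[? ?] [? ?]] [[? ?] [? ?]]] [[[? ?] [? ?]] [[? ?] [? ?]]]
  [[[? ?] [? ?]] [[? ?] [? ?]]] [[[? ?] [? ?]] [[? ?] [? ?]]]
  [[[? ?] [? ?]] [[? ?] [? ?]]] [[[? ?] [? ?]] [[? ?] [? ?]]] /=.
ring.
Qed.

Lemma iter8_hphi P : iter 8 (hphi B) P = P.
Proof.
move: P => [[[a b] c] [[[[[? ?] [? ?]] [[? ?] [? ?]]] [[[? ?] [? ?]] [[? ?] [? ?]]]]
   [[[? ?] [? ?]] [[? ?] [? ?]]]]] /=.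
by rewrite !opprK.
Qed.

(** Inner product of the components fixed by [hphi]; the factor 2 counts the entries (1,0) and
    (0,1). *)
Definition hdot_fixed P Q : R :=
  P.1.1.1 * Q.1.1.1 + P.1.1.2 * Q.1.1.2 + P.1.2 * Q.1.2
  + 2 * (P.2.1.1.1.1.1 * Q.2.1.1.1.1.1 + P.2.1.1.1.1.2 * Q.2.1.1.1.1.2).

(** The group average is the orthogonal projection to the fixed matrices: on the remaining
    coordinates [hphi] has no eigenvalue 1. *)
Lemma sum_hdot_hphi X P :
  \sum_(k < 8) hdot B X (iter k (hphi B) P) = 8 * hdot_fixed X P.
Proof.
rewrite !big_ord_recl big_ord0 /hdot_fixed.
move: X P => [[[a b] c] [[x y] z]] [[[a' b'] c'] [[x' y'] z']].
move: x y z x' y' z' => [[[? ?] [? ?]] [[? ?] [? ?]]] [[[? ?] [? ?]] [[? ?] [? ?]]]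
  [[[? ?] [? ?]] [[? ?] [? ?]]] [[[? ?] [? ?]] [[? ?] [? ?]]]
  [[[? ?] [? ?]] [[? ?] [? ?]]] [[[? ?] [? ?]] [[? ?] [? ?]]] /=.
ring.
Qed.

Lemma hmx_hermitian P : ohermitian (hmx P).
Proof.
move: P => [[[a b] c] [[[[[? ?] [? ?]] [[? ?] [? ?]]] [[[? ?] [? ?]] [[? ?] [? ?]]]]
   [[[? ?] [? ?]] [[? ?] [? ?]]]]] i j.
by rewrite !mxE; case: i j => [[|[|[|i]]] hi] [[|[|[|j]]] hj] //=; rewrite ?opprK ?oppr0.
Qed.

Lemma oscale1 (x : oct R) : oscale B 1 x = x.
Proof. by move: x => [[[? ?] [? ?]] [[? ?] [? ?]]] /=; rewrite !mul1r. Qed.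

Lemma eq_mx3 (T : Type) (M N : 'M[T]_3) :
  let o0 := @Ordinal 3 0 isT in let o1 := @Ordinal 3 1 isT in let o2 := @Ordinal 3 2 isT in
  [/\ M o0 o0 = N o0 o0, M o0 o1 = N o0 o1 & M o0 o2 = N o0 o2] ->
  [/\ M o1 o0 = N o1 o0, M o1 o1 = N o1 o1 & M o1 o2 = N o1 o2] ->
  [/\ M o2 o0 = N o2 o0, M o2 o1 = N o2 o1 & M o2 o2 = N o2 o2] -> M = N.
Proof.
move=> o0 o1 o2 [? ? ?] [? ? ?] [? ? ?]; apply/matrixP => i j.
have o3 (k : 'I_3) : [\/ k = o0, k = o1 | k = o2].
  by case: k => [[|[|[|k]]] hk]; [apply: Or31|apply: Or32|apply: Or33|]; try apply: val_inj.
by have [] := o3 i => ->; have [] := o3 j => ->.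
Qed.

(** The matrix is w w^* with first entry of w real, so its square involves only products in u and v,
    which generate an associative algebra by Artin's theorem. Hence the square is |w|^2 w w^*, and
    |w|^2 is the trace. *)
Lemma outer_idem w : htrace B (outer B w) = 1 ->
  omulmx (hmx (outer B w)) (hmx (outer B w)) = hmx (outer B w).
Proof.
move: w => [[s [[[u0 u1] [u2 u3]] [[u4 u5] [u6 u7]]]] [[[v0 v1] [v2 v3]] [[v4 v5] [v6 v7]]]].
rewrite /htrace /= => n1; set P := (_, _).
apply: eq_mx3; split.
(* Multiplying the right side by 1 and then writing 1 as the trace turns each coordinate into an
   unconditional polynomial identity. *)
all: rewrite !mxE !big_ord_recl big_ord0 !mxE -[RHS]oscale1 -n1 /=.
all: congr ((((_, _), (_, _)), ((_, _), (_, _)))).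
all: ring.
Qed.

End Geometry.

(** * Vanishing of the slacks and assembly of the simplex *)

Section Orbits.
Variable R : realType.
Local Notation B := (base_alg R).
Local Notation phi := (hphi B).

Lemma iter_mod (T : Type) (f : T -> T) (x : T) d k :
  iter d f x = x -> iter k f x = iter (k %% d) f x.
Proof.
move=> fd; rewrite {1}(divn_eq k d) addnC iterD.
by congr (iter _ f _); elim: (k %/ d)%N => // q ih; rewrite mulSn iterD ih.
Qed.

Lemma hdot_iter k (P Q : herm R) : hdot B (iter k phi P) (iter k phi Q) = hdot B P Q.
Proof. by elim: k => //= k ih; rewrite hdot_hphi. Qed.

Lemma otrace_hmx (P : herm R) : otrace (hmx P) = oreal (htrace B P).
Proof.
move: P => [[[a b] c] [[x y] z]]; rewrite /otrace !big_ord_recl big_ord0 !mxE /=.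
by rewrite /oreal /htrace /= !addr0 addrA.
Qed.

Lemma iter_hphi_outer k w : iter k phi (outer B w) = outer B (iter k (@wphi R) w).
Proof. by elim: k => //= k ->; exact: hphi_outer. Qed.

Lemma htrace_iter k P : htrace B (iter k phi P) = htrace B P.
Proof. by elim: k => //= k <-; case: (iter k _ _) => [[[? ?] ?] [[? ?] ?]]. Qed.

(* Orbit [i] has length [d i], slack [e i] and representative [A i]. *)
Variables (n N : nat) (d : nat -> nat) (e : nat -> R) (A : nat -> herm R).
Local Notation c := ((N%:R - 3) / (3 * (N%:R - 1)) : R).
Hypothesis N3 : (3 < N)%N.
Hypothesis dval : forall i, (i < n)%N -> d i \in [:: 8; 4; 2; 1]%N.
Hypothesis A_period : forall i, (i < n)%N -> iter (d i) phi (A i) = A i.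
Hypothesis A_outer : forall i, (i < n)%N -> exists w, A i = outer B w.
Hypothesis A_trace : forall i, (i < n)%N -> htrace B (A i) = 1.
Hypothesis d_sum : (\sum_(i < n) d i = N)%N.
Let G i j k := hdot B (A i) (iter k phi (A j)).
Hypothesis G_diag : forall i, (i < n)%N -> forall k, (0 < k <= (d i)./2)%N ->
  G i i k = c + (e i + e i).
Hypothesis G_lt : forall i j, (i < j)%N -> (j < n)%N -> forall k, (k < d j)%N ->
  G i j k = c + (e i + e j).
Hypothesis sum_a : \sum_(i < n) (d i)%:R * (A i).1.1.1 = N%:R / 3.
Hypothesis sum_b : \sum_(i < n) (d i)%:R * (A i).1.1.2 = N%:R / 3.
Hypothesis sum_x0 : \sum_(i < n) (d i)%:R * (A i).2.1.1.1.1.1 = 0.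
Hypothesis sum_x1 : \sum_(i < n) (d i)%:R * (A i).2.1.1.1.1.2 = 0.

(** Apply the isometry [phi] 8 - k times to both arguments and use that its eighth power is the
    identity. *)
Lemma G_sym i j k : (k <= 8)%N -> G i j k = G j i (8 - k).
Proof.
by move=> k8; rewrite /G -(hdot_iter (8 - k)) -iterD subnK// iter8_hphi hdotC.
Qed.

Lemma G_mod i j k : (j < n)%N -> G i j k = G i j (k %% d j).
Proof. by move=> jn; rewrite /G (iter_mod k (A_period jn)). Qed.

Lemma G_val i j k : (i < n)%N -> (j < n)%N -> ~~ ((i == j) && (d i %| k)%N) ->
  G i j k = c + (e i + e j).
Proof.
move=> iN jn; case: (ltngtP i j) => [ij _|ji _|<- {j jn} /=].
- rewrite G_mod// G_lt// ltn_pmod//.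
  by have := dval jn; rewrite !inE => /or4P[] /eqP ->.
- rewrite /G (iter_mod k (iter8_hphi _)) -/(G i j _) G_sym; last by rewrite ltnW// ltn_pmod.
  rewrite [e i + _]addrC G_mod// G_lt// ltn_pmod//.
  by have := dval iN; rewrite !inE => /or4P[] /eqP ->.
- rewrite G_mod// /dvdn; have := dval iN; set r := (k %% d i)%N.
  have rd : (0 < d i)%N -> (r < d i)%N by exact: ltn_pmod.
  move=> dv r0; have [rh|rh] := leqP r (d i)./2; first by rewrite G_diag// lt0n r0.
  (* Here [r] exceeds half of [d i]. As [d i] divides 8, the shift [8 - r] is congruent to
     [d i - r], which lies in the range of [G_diag]. *)
  have r8 : (r <= 8)%N by move: dv rd; rewrite !inE => /or4P[] /eqP -> /(_ isT); lia.
  rewrite G_sym// G_mod// G_diag//.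
  move: dv rd rh r0; rewrite !inE => /or4P[] /eqP -> /(_ isT);
    by move: r {r8} => [|[|[|[|[|[|[|[|r]]]]]]]].
Qed.

(** The eight shifts run through the orbit 8 / d j times. *)
Lemma sum_G i j : (j < n)%N -> \sum_(k < d j) G i j k = (d j)%:R * hdot_fixed (A i) (A j).
Proof.
move=> jn; have := sum_hdot_hphi (A i) (A j).
have m k := @G_mod i j k jn.
have := dval jn; rewrite !inE => /or4P[] /eqP dj; rewrite dj in m *.
- by [].
- by rewrite !big_ord_recl !big_ord0 -!/(G i j _) /= (m 4) (m 5) (m 6) (m 7) /=; lra.
- by rewrite !big_ord_recl !big_ord0 -!/(G i j _) /= (m 2) (m 3) (m 4) (m 5) (m 6) (m 7) /=; lra.
- by rewrite !big_ord_recl !big_ord0 -!/(G i j _) /= (m 1%N)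
    (m 2) (m 3) (m 4) (m 5) (m 6) (m 7) /=; lra.
Qed.

Lemma natr_sum_d : \sum_(i < n) (d i)%:R = N%:R :> R.
Proof. by rewrite -d_sum natr_sum. Qed.

(** The left side is the inner product of [A i] with the sum of all points. Only fixed components
    contribute, and there the sum is (N/3) I, so the result is N/3 times the trace of [A i]. *)
Lemma row_sum i : (i < n)%N -> \sum_(j < n) \sum_(k < d j) G i j k = N%:R / 3.
Proof.
move=> iN; under eq_bigr do rewrite sum_G//.
have sum_c : \sum_(j < n) (d j)%:R * (A j).1.2 = N%:R / 3.
  have : \sum_(j < n) (d j)%:R * htrace B (A j) = N%:R.
    by rewrite -natr_sum_d; apply: eq_bigr => j _; rewrite A_trace// mulr1.
  rewrite /htrace /=; under eq_bigr do rewrite !mulrDr.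
  by rewrite !big_split /= sum_a sum_b; lra.
rewrite /hdot_fixed.
transitivity (\sum_(j < n) ((A i).1.1.1 * ((d j)%:R * (A j).1.1.1)
  + (A i).1.1.2 * ((d j)%:R * (A j).1.1.2) + (A i).1.2 * ((d j)%:R * (A j).1.2)
  + (2 * (A i).2.1.1.1.1.1 * ((d j)%:R * (A j).2.1.1.1.1.1)
  + 2 * (A i).2.1.1.1.1.2 * ((d j)%:R * (A j).2.1.1.1.1.2)))).
  by apply: eq_bigr => j _; ring.
rewrite !big_split /= -!mulr_sumr sum_a sum_b sum_c sum_x0 sum_x1.
by have := A_trace iN; rewrite /htrace /= => h; rewrite -!mulrDl h; ring.
Qed.

Lemma G_self i : (i < n)%N -> G i i 0 = 1.
Proof.
move=> iN; have [w Aw] := A_outer iN; have t1 := A_trace iN.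
rewrite /G /= -oinner_hmx /oinner Aw outer_idem -?Aw// otrace_hmx t1.
by [].
Qed.

(** The constant [c] satisfies 1 + (N - 1) c = N/3, so [row_sum] reduces to (N - 2) e_i + E = 0 with
    E the sum of all d_j e_j. Summing this with weights d_i gives (2N - 2) E = 0; hence E = 0 and
    every e_i = 0. *)
Lemma slack_zero i : (i < n)%N -> e i = 0.
Proof.
pose E := \sum_(j < n) (d j)%:R * e j.
have N3R : 3 < N%:R :> R by rewrite (ltr_nat R 3).
have eq i' : (i' < n)%N -> (N%:R - 2) * e i' + E = 0.
  move=> iN; have := row_sum iN.
  have -> : \sum_(j < n) \sum_(k < d j) G i' j k =
     \sum_(j < n) ((d j)%:R * (c + e i' + e j) + (if j == i' :> nat then 1 - c - 2 * e i' else 0)).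
    apply: eq_bigr => j _; case: eqP => [ji|/eqP ji].
      subst i'.
      have d0 : (0 < d j)%N by have := dval (ltn_ord j); rewrite !inE => /or4P[] /eqP ->.
      rewrite -(prednK d0) big_ord_recl /= G_self//.
      rewrite (eq_bigr (fun=> c + (e j + e j))) => [|k _]; last first.
        by apply: G_val => //; rewrite eqxx /= gtnNdvd//; have := ltn_ord k; rewrite /bump; lia.
      by rewrite big_const_ord iter_addr_0 -mulr_natl -[_.+1%:R]natr1; ring.
    rewrite (eq_bigr (fun=> c + (e i' + e j))) => [|k _].
      by rewrite big_const_ord iter_addr_0 -mulr_natl; ring.
    by apply: G_val => //; rewrite eq_sym (negbTE ji).
  rewrite big_split /= -(big_mkcond (fun j : 'I_n => j == i' :> nat)) /=.
  rewrite [X in _ + X](big_pred1 (Ordinal iN)); last first.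
    by move=> j; apply/idP/idP => [/eqP ji|/eqP ->] //; apply/eqP/val_inj.
  under eq_bigr do rewrite mulrDr.
  rewrite big_split /= -mulr_suml natr_sum_d -/E => h.
  have hc : 1 + (N%:R - 1) * c = N%:R / 3 by field; lra.
  move: h hc; move: c => c' h hc; lra.
have E0 : E = 0.
  have : \sum_(j < n) (d j)%:R * ((N%:R - 2) * e j + E) = 0.
    by rewrite big1// => j _; rewrite eq// mulr0.
  under eq_bigr do rewrite mulrDr mulrCA.
  rewrite big_split /= -mulr_sumr -/E -mulr_suml natr_sum_d => h.
  have : (2 * N%:R - 2) * E = 0 by lra.
  by move/eqP; rewrite mulf_eq0 => /orP[/eqP|/eqP//]; lra.
move=> /eq; rewrite E0 addr0 => /eqP; rewrite mulf_eq0 => /orP[/eqP|/eqP//]; lra.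
Qed.

Lemma tight_simplex_of_orbits : exists P : 'I_N -> 'M[oct R]_3, tight_simplex P.
Proof.
pose pts := [seq (i, k) | i <- iota 0 n, k <- iota 0 (d i)].
have size_pts : size pts = N.
  rewrite size_allpairs_dep -d_sum sumnE big_map -(big_mkord xpredT) /index_iota subn0.
  by apply: eq_bigr => i _; rewrite size_iota.
have uniq_pts : uniq pts.
  apply: allpairs_uniq_dep => [|i _|]; rewrite ?iota_uniq//.
  by move=> [i k] [i' k'] _ _ /= [-> ->].
have mem_pts p : p \in pts -> (p.1 < n)%N /\ (p.2 < d p.1)%N.
  by move=> /allpairsPdep[i [k [+ + ->]]]; rewrite !mem_iota.
pose pt (t : 'I_N) := nth (0%N, 0%N) pts t.
have ptP t : ((pt t).1 < n)%N /\ ((pt t).2 < d (pt t).1)%N.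
  by apply: mem_pts; rewrite mem_nth// size_pts.
pose P t := hmx (iter (pt t).2 phi (A (pt t).1)).
have trace_P t : htrace B (iter (pt t).2 phi (A (pt t).1)) = 1.
  by rewrite htrace_iter A_trace//; case: (ptP t).
have idem t : omulmx (P t) (P t) = P t.
  have [w Aw] := A_outer (ptP t).1; have := trace_P t.
  by rewrite /P Aw iter_hphi_outer => /outer_idem.
have inner t t' : t != t' -> oinner (P t) (P t') = c.
  move=> tt'; have neq : pt t != pt t' by rewrite nth_uniq// size_pts.
  rewrite oinner_hmx; have [] := ptP t; have [] := ptP t'.
  move: (pt t) (pt t') neq => [i k] [j k'] /= neq jn kj' iN ki.
  have k8 : (k <= 8)%N.
    by have := dval iN; rewrite !inE => /or4P[] /eqP di; rewrite di in ki; lia.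
  (* Shifting both points by [8 - k] returns the first one to its representative. *)
  rewrite -(hdot_iter (8 - k)) -!iterD subnK// iter8_hphi -/(G _ _ _) G_val// ?slack_zero ?addr0//.
  apply/negP => /andP[/eqP ij]; subst j.
  have {}neq : k != k' by apply: contraNneq neq => ->.
  have := dval iN; rewrite !inE => /or4P[] /eqP di; rewrite di in ki kj' *; lia.
exists P; split; last split => //.
- move=> t; split; first exact: hmx_hermitian.
  by split => //; rewrite otrace_hmx trace_P.
- move=> t t' PP; apply/eqP/negPn/negP => tt'.
  (* A repeated point would have inner product 1 with itself, being idempotent of trace 1; but c = 1
     means N - 3 = 3 (N - 1), impossible for N > 3. *)
  have := inner _ _ tt'; rewrite -PP /oinner idem otrace_hmx trace_P /=.
  have N3R : 3 < N%:R :> R by rewrite (ltr_nat R 3).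
  have c0 : 3 * (N%:R - 1) != 0 :> R by rewrite gt_eqF//; lra.
  move=> h; have : N%:R - 3 = 3 * (N%:R - 1) :> R by rewrite -[RHS]mul1r [X in _ = X * _]h divfK.
  lra.
Qed.

End Orbits.

(** * Reading off the orbit conditions from a zero of the system *)

Section Zeros.
Variable R : realType.
Local Notation B := (base_alg R).
Local Notation vanish := (List.Forall (fun x : R => x = 0)).
Local Notation o0 := (Orbit 1 0 (outer B (0, a0 (octA R), a0 (octA R)))).

Lemma vanish_cat s t : vanish (s ++ t) -> vanish s /\ vanish t.
Proof. by elim: s => //= x s ih h; inversion h; have [] := ih H2; split=> //; constructor. Qed.

Lemma vanish_nth s : (forall i, nth 0 s i = 0) -> vanish s.
Proof.
elim: s => [|x s ih] h; constructor; first exact: (h 0%N).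
by apply: ih => i; exact: (h i.+1).
Qed.

Lemma vanish_map f a n k : vanish [seq f i | i <- iota a n] ->
  (a <= k < a + n)%N -> f k = 0.
Proof.
elim: n a => [|n ih] a /=; first by move=> _; lia.
move=> h; inversion h; have [->//|ka] := eqVneq k a.
by move=> ?; apply: (ih a.+1) => //; lia.
Qed.

Lemma vanish_flatten (f : orbit R -> seq R) os j : vanish (flatten [seq f p | p <- os]) ->
  (j < size os)%N -> vanish (f (nth o0 os j)).
Proof.
by elim: os j => [|o os ih] [|j] //= /vanish_cat[h h'] //; exact: ih.
Qed.

Lemma pair_eqs_zero c os : vanish (pair_eqs B c os) ->
  (forall i, (i < size os)%N -> htrace B (orep (nth o0 os i)) = 1 /\
     forall k, (0 < k <= (olen (nth o0 os i))./2)%N ->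
       pair_eq B c (nth o0 os i) (nth o0 os i) k = 0) /\
  (forall i j, (i < j)%N -> (j < size os)%N -> forall k, (k < olen (nth o0 os j))%N ->
       pair_eq B c (nth o0 os i) (nth o0 os j) k = 0).
Proof.
elim: os => [|o os ih] //= h; inversion h as [|x s h1 h2].
have [h3 /vanish_cat[h4 /ih[h5 h6]]] := vanish_cat h2.
split=> [[|i] //= id|[|i] [|j] //= ij jn k kj].
- split; first by apply/eqP; rewrite -subr_eq0; apply/eqP.
  by move=> k kd; apply: (vanish_map h3); lia.
- exact: (h5 i id).
- by apply: (vanish_map (vanish_flatten h4 jn)); rewrite /= add0n.
- exact: (h6 i j).
Qed.

Lemma orbit_sumE f os :
  orbit_sum B f os = \sum_(i < size os) (olen (nth o0 os i))%:R * f (orep (nth o0 os i)).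
Proof.
have it n (x y : R) : iter n (aadd B x) y = n%:R * x + y.
  by elim: n => [|n /= ->]; [rewrite mul0r add0r|rewrite -[n.+1%:R]natr1; ring].
by elim: os => [|o os ih]; rewrite ?big_ord0// big_ord_recl /= it ih.
Qed.

Lemma size_orbits ds l : size (orbits B ds l) = size ds.
Proof. by elim: ds l => //= d ds ih l; rewrite ih. Qed.

Lemma olen_orbits ds l i : (i < size ds)%N -> olen (nth o0 (orbits B ds l) i) = nth 0%N ds i.
Proof. by elim: ds l i => [|d ds ih] l [|i] //= ?; exact: ih. Qed.

Lemma point_period d l : d \in [:: 8; 4; 2; 1]%N ->
  iter d (@wphi R) (point B d l) = point B d l.
Proof. by rewrite !inE => /or4P[] /eqP -> /=; rewrite ?opprK ?oppr0 ?opprK. Qed.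

Lemma orbits_outer ds l i : (i < size ds)%N ->
  exists w, orep (nth o0 (orbits B ds l) i) = outer B w /\
    (nth 0%N ds i \in [:: 8; 4; 2; 1]%N -> iter (nth 0%N ds i) (@wphi R) w = w).
Proof.
elim: ds l i => [|d ds ih] l [|i] //= id; last exact: ih.
by exists (point B d (take (params d) l)); split=> //; exact: point_period.
Qed.

Definition sizes_ok (N : nat) (ds : seq nat) : bool :=
  all (fun d => d \in [:: 8; 4; 2; 1]%N) ds && (sumn ds == N).

Lemma tight_simplex_of_zero N ds l : (3 < N)%N -> sizes_ok N ds ->
  (forall i, nth 0 (system B ((N%:R - 3) / (3 * (N%:R - 1))) (N%:R / 3) ds l) i = 0) ->
  exists P : 'I_N -> 'M[oct R]_3, tight_simplex P.
Proof.
move=> N3 /andP[/allP dsv /eqP dsN] /vanish_nth/vanish_cat.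
set os := orbits B ds l => -[/pair_eqs_zero[eq1 eq2] eq3].
have sos : size os = size ds by exact: size_orbits.
have len i : (i < size ds)%N -> olen (nth o0 os i) = nth 0%N ds i by exact: olen_orbits.
have dval i : (i < size ds)%N -> nth 0%N ds i \in [:: 8; 4; 2; 1]%N.
  by move=> id; apply: dsv; exact: mem_nth.
rewrite sos in eq1 eq2.
pose A i := orep (nth o0 os i).
have sumE f : orbit_sum B f os = \sum_(i < size ds) (nth 0%N ds i)%:R * f (A i).
  by rewrite orbit_sumE sos; apply: eq_bigr => i _; rewrite len.
inversion eq3 as [|x1 s1 ha ea]; inversion ea as [|x2 s2 hb eb].
inversion eb as [|x3 s3 hx ex]; inversion ex as [|x4 s4 hy _].
apply: (@tight_simplex_of_orbits R (size ds) N (nth 0%N ds)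
  (fun i => oslack (nth o0 os i)) A) => //.
- move=> i id; have [w [Aw pw]] := orbits_outer l id.
  by rewrite /A /os Aw iter_hphi_outer pw ?dval.
- by move=> i id; have [w [Aw _]] := orbits_outer l id; exists w.
- by move=> i id; have [] := eq1 i id.
- by transitivity (sumn ds) => //; rewrite sumnE (big_nth 0%N) big_mkord.
- move=> i id k kd; have [_ /(_ k)] := eq1 i id; rewrite len// => /(_ kd) h.
  by apply/eqP; rewrite -subr_eq0; apply/eqP.
- move=> i j ij jd k kd; have := eq2 i j ij jd k; rewrite len// => /(_ kd) h.
  by apply/eqP; rewrite -subr_eq0; apply/eqP.
- by move: ha; rewrite /= sumE => /eqP; rewrite subr_eq0 => /eqP.
- by move: hb; rewrite /= sumE => /eqP; rewrite subr_eq0 => /eqP.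
- by move: hx; rewrite sumE.
- by move: hy; rewrite sumE.
Qed.

End Zeros.

(** * Numerical data for N = 5, ..., 23 *)

Section Data.
Local Open Scope Z_scope.

(* Approximate zeros in units of 2^-32, found by Newton iteration from random starting
   points, and the indices of the variables that are to be moved, in an order in which
   Gauss-Jordan elimination needs no further pivoting. *)
Definition newton_data : seq (seq Z * seq nat) := [::
   ([::
     0; 2598773117; -622467798; 347192762; 624548078; -1763210062; 66585618; 849245701;
     -1402944416; -2234331762; 0; 1931343214; 3350316130; -1868699895],
    [::
     1; 0; 5; 10; 12; 9; 7; 2; 3]%N);
   ([::
     0; -2791400762; 924076513; 330467106; 128695748; 1732351768; -30145609; -1049972517;
     2359858090; 42584669; 0; -1692012897; -3048993171; -1090377187; 1984778482; 1076665706],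
    [::
     1; 0; 7; 10; 4; 12; 14; 8; 5; 2; 3]%N);
   ([::
     0; -2749319976; -656928361; -387951542; -48724652; 1407360670; -2025805474; -111601652;
     -502006488; -1988600278; 0; 31010648; -172714053; 3679744489; 2207769898; 34421522; 0;
     3578468696; -2015865927; -1256021669],
    [::
     1; 0; 6; 10; 3; 2; 13; 14; 16; 17; 5; 9; 18; 4]%N);
   ([::
     0; 2479700525; 0; 0; -774025779; 618807796; -270936351; 606515845; -1006987458; 1926547165;
     -1615673717; 29467291; 1445889235; -481729043; -931964256; 356145166; -18405381; 468242190],
    [::
     1; 0; 12; 10; 9; 7; 4; 2; 3]%N);
   ([::
     0; 2456286398; 44311321; 454290944; 1033046618; -845584257; 1069685070; 309730660;
     -1166949138; 950474012; -1165341224; 601274201; 1712255293; -13962403; -1129624342;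
     270866157; -940168590; -180633477; 0; -2659603217; 327391074; 3356496669],
    [::
     1; 0; 9; 10; 8; 18; 21; 12; 14; 2; 3]%N);
   ([::
     0; 2096593578; -50987620; 373146795; -688189585; 877026794; 102974569; 1033255321;
     -979482086; 2018523383; -1548703477; 412583919; 1465014531; -624024941; -666807566;
     -592014963; 418552863; 692600136; 0; -3627913304; -117864246; 862575381; 808526643;
     1968081689],
    [::
     1; 0; 9; 10; 5; 18; 11; 19; 23; 7; 12; 2; 3]%N);
   ([::
     0; -2581918881; 541109404; 2123549; 671075477; 548519790; -873715945; 69294033; 1616346498;
     -126549185; -1272574128; -714103957; -445814553; 1695853931; 633910855; 77082439; 1129698244;
     671999675; 0; 2315628606; 2472770276; 1584162934; 908729422; -1906476865; 0; -1892973604;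
     145395830; 3852564738],
    [::
     1; 0; 13; 10; 8; 18; 22; 24; 19; 23; 20; 27; 7; 5; 2; 3]%N);
   ([::
     0; -1956378896; -22127155; -179253793; 686120193; 1453810952; 1098340252; 1817732431;
     -830906682; 697319484; -692342532; -323588219; -666605161; 170676039; 110511723; 427374978;
     1766086097; 1394184884; 0; -3285103850; 26354783; 213502132; -86807842; 1335929455;
     -206916338; -1434789560; 774300222; -1765032475],
    [::
     1; 0; 9; 5; 11; 18; 22; 7; 12; 19; 23; 25; 8; 16; 2; 3]%N);
   ([::
     0; -2177937408; 526141573; -216616987; 378756999; -279307655; -535433714; 2073256075;
     81101550; 121097664; 1053378025; 1187211473; 585486478; 643302372; -267449716; -83417193;
     -1338569470; -1845488658; 0; -2461658710; -1272620653; 278752078; -390514384; -2767097103;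
     554308978; -1066788112; 420738643; 1121637299; 0; 4213020974; -798430287; -244351027],
    [::
     1; 0; 7; 14; 10; 18; 24; 5; 15; 28; 23; 27; 20; 19; 29; 25; 17; 2; 3]%N);
   ([::
     0; 2443071859; 590149809; 355750229; -761726445; -744896892; -310732058; -552619540;
     -1517882291; 59057436; 217056867; 1020601891; 76414032; 467348692; -52036401; -2149798578;
     653037844; 1339782534; 0; 3095740042; -923246680; -546549818; 2156192781; 147590327;
     1369615785; -984760970; 432279932; 92837546; 0; 28099422; -1809650474; -3293348175;
     -1215411290; -1687528623],
    [::
     1; 0; 17; 6; 11; 18; 5; 4; 8; 28; 7; 19; 24; 22; 21; 20; 31; 33; 10; 16; 2; 3]%N);
   ([::
     0; -1952901617; 128900211; -855009388; -1024177252; -1556671752; -131725000; 1674131261;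
     63320811; 810962906; 1334966394; 667469321; 315924664; -1377531707; 1016027385; 694258994;
     618792468; -899497552; 0; -2596209856; -1100212215; 1357938268; 814816464; -969007143;
     528124018; -1045851957; 922436273; 2196693996; 0; -3069309518; 2028847960; 785230416;
     1399031602; -1528392255; 0; -3990059931; -762553198; -1394517277],
    [::
     1; 0; 6; 10; 14; 18; 9; 5; 22; 28; 4; 13; 19; 27; 25; 20; 24; 34; 29; 33; 36; 35; 32; 3; 2;
     21]%N);
   ([::
     0; -2962851829; 357213721; -295450991; 1230222980; 73905493; -1601155334; -709541126;
     -278516890; 809425332; 474228906; -1202591548; -587205695; -10026844; -629570187; -667743134;
     -488940835; -1018444077; 0; 1875989984; 564166832; -466621633; 795664428; 1648499488;
     -1057767419; -26270671; -1312406780; -188445721; -1471154814; -352409712; -1033408469;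
     -1078866005; 1150325618; 540810185; -1420111450; 102238021],
    [::
     1; 0; 4; 8; 11; 18; 13; 15; 10; 5; 27; 12; 24; 19; 9; 20; 23; 26; 6; 34; 2; 3]%N);
   ([::
     0; 2448160821; -8172926; -789437357; -507962746; 1312123002; 160005958; 441707985;
     -2056612149; 1108131996; -1129953547; -131140792; -113026265; 697435807; 297755963;
     -1293149285; 323507767; -716399455; 0; -2200645245; -15002446; -691577626; -727702991;
     -110845938; 1509831356; 1047013446; 370281338; 419696637; -1062987613; 842136954;
     -2315381416; -366641229; 302695946; -1104384574; 306197368; -393546507; 0; -4223849261;
     24634258; -777968282],
    [::
     1; 0; 7; 10; 5; 18; 11; 6; 12; 13; 16; 20; 25; 8; 30; 24; 33; 26; 19; 36; 37; 23; 15; 28; 3]%N);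
   ([::
     0; -2433850247; 140810958; -1158339587; 1174891770; -472760429; -1050457455; 1481487090;
     468524975; -514636794; 862131200; 1001584046; -135668916; -19224314; 19313032; 14084385;
     -389347165; -1964091411; 0; -2696172923; -499894133; 701483629; 80874609; 239624091;
     1731629151; -413236105; 24672526; -443677329; 901930600; -1066122764; -1559555221;
     -1269358023; 756530317; 32250743; -655849481; 87202662; 0; -1602601135; 2508642279;
     2315994679; 1971175055; 579452450],
    [::
     1; 0; 11; 17; 10; 18; 22; 12; 7; 9; 26; 13; 5; 36; 15; 19; 3; 29; 25; 24; 20; 33; 38; 40; 30;
     21; 8; 2]%N);
   ([::
     0; -2685148211; 589695128; -810864681; 217720534; -1028711324; -1295823713; -309794870;
     -283722908; 946213412; 19560877; -1258626073; -503718107; 220588445; -289549954; -291543504;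
     -261186451; -2061774244; 0; 2496502670; 422534186; -1013317176; 1125121888; -376114223;
     -738899831; -1014776069; -131871497; -911200976; -406420174; -732295953; -285526587;
     -1804950891; 778043365; 1570713969; -245976117; 65450515; 0; -568248302; 3597177789;
     990628931; -2041397728; 188413198; 0; 2939931101; 2828865312; 1342039583],
    [::
     1; 0; 15; 11; 5; 18; 9; 14; 12; 4; 27; 13; 8; 36; 26; 42; 19; 3; 33; 24; 34; 29; 21; 2; 38;
     40; 37; 43; 22; 17; 20; 23]%N);
   ([::
     0; 3067400644; 181522316; -235665551; -324270677; 833934504; -743196540; -82531392;
     -1119985286; 1485038660; 1050835751; -45670390; 1135279238; 514746816; 235453679; 499514351;
     -420029635; 994137027; 0; 1967710660; 488059234; 104982123; -743165412; 958220898;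
     -387725792; -346219623; 759288274; -1641909576; 490166082; 1297786936; -1903067351;
     -513462731; -1131268257; -716911158; -565610485; 1178601229; 0; -2045216259; 1483619173;
     -504891567; 1940726084; 2044906224; -1129858740; 1579307128; -201589360; -219781579],
    [::
     1; 0; 10; 7; 5; 18; 11; 9; 17; 12; 6; 13; 2; 36; 4; 16; 14; 19; 35; 29; 25; 23; 27; 21; 20;
     34; 37; 41; 38; 30; 42; 26; 3]%N);
   ([::
     0; -2514231856; 1146057212; -151989190; 924372938; 58732048; 367584271; 932256112;
     -487831427; 1327768086; 413359451; 380615446; 874798058; -684506836; 1478706076; 1733430419;
     -375652825; -209115382; 0; -2316173566; -905767888; 711391435; 529571549; 51263979;
     -1016449701; 552762508; -848782314; -1261858299; 279500646; -1573378106; 854575217;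
     -1523985339; 267710993; 1330610805; -396354445; -464028160; 0; -2118264888; -421117923;
     -903860509; -1853159877; 2596740304; 173966198; 512579908; 1550180580; 303430134; 0;
     -4206049152; -641967312; -586321220],
    [::
     1; 0; 7; 16; 13; 18; 11; 9; 14; 3; 35; 12; 2; 36; 5; 6; 4; 46; 19; 26; 29; 20; 31; 23; 33;
     22; 43; 24; 41; 44; 37; 27; 47; 39; 42; 25; 8]%N);
   ([::
     0; -2094538704; 261900868; -977513926; -502141566; -293339130; -1779813617; 60111126;
     -627080862; 693386688; -1155510818; -718548555; 1682620519; -343304707; -448597542;
     -1256595428; -631878393; 1292995533; 0; 3011184198; 275992656; -414454144; 24867109;
     959419886; 245066173; -170104322; 1555458876; -329469172; 518236207; -1028940800; 691077246;
     -1056492206; -366780581; -572718549; -677487196; -1323213761; 0; -2344899563; 1451619372;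
     603301576; -2581994077; 749169569; -1387129513; -694040271; 510852723; 763072328; 0;
     1680375866; 3378881170; -219241856; 1341715633; -1535570001],
    [::
     1; 0; 12; 8; 5; 18; 7; 30; 11; 24; 15; 25; 6; 36; 10; 4; 2; 46; 9; 19; 35; 20; 26; 29; 23;
     34; 22; 21; 31; 45; 40; 42; 38; 37; 44; 48; 51; 39; 32; 28; 27]%N);
   ([::
     0; 3021501190; -180433206; 496258948; 975312331; -1259105102; 1069923932; 258679655;
     -587561309; 981669095; -751671544; -501830560; 448620722; 4974320; 840437902; 1490774222;
     15807728; -184900004; 0; -2318472455; 318712585; 594468224; -636555404; -21570105;
     -1604099644; 504977780; 443581591; -218494477; 1329627989; -289664610; 1753376707;
     -1375179952; 593917715; 739023048; 1055977384; 553986572; 0; -1316366101; -480465924;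
     -2113528353; -1929318205; 1117811227; -211555418; 2389547932; -785385290; -820231072; 0;
     -2644440702; -2442636835; 1158071632; -265042462; 2018867338; 0; -2114084696; 2448269363;
     2825485285],
    [::
     1; 0; 10; 16; 5; 18; 12; 7; 15; 6; 13; 23; 24; 36; 11; 4; 8; 46; 3; 9; 19; 31; 28; 25; 26;
     22; 20; 21; 35; 2; 29; 52; 43; 40; 39; 38; 47; 53; 48; 51; 49; 55; 33; 14; 34; 27]%N)].

Lemma newton_data_certified :
  all (fun N => let: (xs, piv) := nth ([::], [::]) newton_data (N - 5) in certificate N xs piv)
      (iota 5 19).
Proof. by vm_compute. Qed.

End Data.

Lemma orbit_sizes_ok : all (fun N => sizes_ok N (orbit_sizes N)) (iota 5 19).
Proof. by []. Qed.

Theorem theorem5p2 (R : realType) (N : nat) :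
  (5 <= N <= 23)%N -> exists P : 'I_N -> 'M[oct R]_3, tight_simplex P.
Proof.
move=> N523; have Nin : N \in iota 5 19 by rewrite mem_iota.
have /allP/(_ N Nin) := newton_data_certified; case: (nth _ _ _) => xs piv cert.
have N3 : (3 < N)%N by case/andP: N523 => /ltnW.
have [l] := certificate_zero R (ltnW (ltnW N3)) cert.
by apply: tight_simplex_of_zero => //; exact: (allP orbit_sizes_ok).
Qed.
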